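(* Let $d>6$ and consider a lattice with vertex set $\mathbb{Z}^d$ and edge set $E(\mathbb{Z}^d)$ satisfying the two-point function estimate: there are constants $0<a\le A<\infty$ such that $$a|x-y|^{2-d}\le \mathbf{P}_{p_c}(x\leftrightarrow y)\le A|x-y|^{2-d}\qquad\text{for all }x,y\in\mathbb{Z}^d .$$ Then there exists a constant $c>0$ such that for every integer $r\ge 1$: (1) $\mathbb{E}|B(0,r)|\ge cr$; (2) $\mathbf{P}(H(r))\ge \dfrac{c}{r}$.
   Context: Lattice: a connected graph with vertex set $\mathbb{Z}^d$ and edge set $E(\mathbb{Z}^d)$ that is invariant under translations of $\mathbb{Z}^d$ and has edges of bounded length. Bond percolation with parameter $p$ retains (opens) each edge independently with probability $p$; $\mathbf{P}_p$ is its law and $p_c$ is the critical probability of the lattice. $x\leftrightarrow y$ is the event that $x,y$ are connected by an open path. Throughout $\mathbf{P}=\mathbf{P}_{p_c}$ and $\mathbb{E}$ is the corresponding expectation. $|x|$ is the Euclidean norm, with the convention $0^{2-d}=1$. Let $d_{p_c}(x,y)$ be the length of the shortest open path between $x$ and $y$ in critical percolation on the lattice ($\infty$ if there is none). Define $B(x,r)=\{u: d_{p_c}(x,u)\le r\}$, $\partial B(x,r)=\{u: d_{p_c}(x,u)=r\}$ and the event $H(r)=\{\partial B(0,r)\neq\emptyset\}$. $|B(0,r)|$ is the number of vertices in $B(0,r)$. *)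

(* Defs.v *)
From HB Require Import structures.
From mathcomp Require Import all_boot all_order all_algebra finmap.
From mathcomp Require Import all_classical all_reals all_analysis.

Set Implicit Arguments.
Unset Strict Implicit.
Unset Printing Implicit Defensive.

Import Order.TTheory GRing.Theory Num.Theory.

Local Open Scope classical_set_scope.
Local Open Scope ring_scope.

(* A graph on V is given by its set E of edges, unordered pairs [fset x; y]. *)
Notation edge E := {e | e \in E}.

Definition edge_open (V : choiceType) (E : pred {fset V}) (e : edge E) :
  set (edge E -> bool) := [set w | w e].

(* The configurations w : edge E -> bool (w e iff e is open), with the product
   sigma-algebra: the one generated by the events "e is open". *)
Notation config E := (g_sigma_algebraType (range (@edge_open _ E))).

Section Percolation.
Variables (R : realType) (V : choiceType) (E : pred {fset V}).

Definition adjacent : rel V := fun x y => [fset x; y]%fset \in E.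

Definition connected_graph : Prop :=
  forall x y, exists s, path adjacent x s /\ last x s = y.

(* The edges are open independently, with probability p each. Such a law exists
   and is unique: see bernoulli_percolation_exists, _unique below. *)
Definition bernoulli_percolation (p : R) (P : probability (config E) R) : Prop :=
  forall F : {fset edge E},
    P [set w : config E | forall e, e \in F -> w e] = (p ^+ #|` F|)%:E.

Definition open_adjacent (w : config E) : rel V :=
  fun x y => oapp w false (insub [fset x; y]%fset).

Definition open_path (w : config E) (x y : V) : set (seq V) :=
  [set s | path (open_adjacent w) x s /\ last x s = y].

Definition connects (x y : V) : set (config E) :=
  [set w | open_path w x y !=set0].

Definition percolates (x : V) : set (config E) :=
  [set w | infinite_set [set y | connects x y w]].

(* The path x :: s has size s edges; ereal_inf set0 = +oo. *)
Definition open_dist (w : config E) (x y : V) : \bar R :=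
  ereal_inf [set (size s)%:R%:E | s in open_path w x y].

Definition open_ball (w : config E) (x : V) (r : nat) : set V :=
  [set u | (open_dist w x u <= r%:R%:E)%E].

Definition open_sphere (w : config E) (x : V) (r : nat) : set V :=
  [set u | open_dist w x u = r%:R%:E].

End Percolation.

Arguments connects {V} E.
Arguments percolates {V} E.
Arguments open_dist R {V E}.
Arguments open_ball R {V E}.
Arguments open_sphere R {V E}.

Section Lattice.
Variables (R : realType) (d : nat) (E : pred {fset 'rV[int]_d}).

Definition euclid_norm (x : 'rV[int]_d) : R :=
  Num.sqrt (\sum_i (x 0 i)%:~R ^+ 2).

(* |x|^(2-d), with the convention 0^(2-d) = 1 *)
Definition norm_pow (x : 'rV[int]_d) : R :=
  if x == 0 then 1 else euclid_norm x ^ (2 - d%:Z).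

Definition lattice : Prop :=
  [/\ forall e, e \in E -> #|` e| = 2%N,
      connected_graph E,
      forall x y z, adjacent E (x + z) (y + z) = adjacent E x y &
      exists L : R, forall x y, adjacent E x y -> euclid_norm (x - y) <= L].

(* P p is the law of percolation with parameter p. *)
Definition critical_probability (P : R -> probability (config E) R) : R :=
  inf [set p | 0 <= p <= 1 /\ (0 < P p (percolates E 0%R))%E].

Definition two_point_estimate (P : probability (config E) R) : Prop :=
  exists a A : R, [/\ 0 < a, a <= A & forall x y,
    ((a * norm_pow (x - y))%:E <= P (connects E x y)
      <= (A * norm_pow (x - y))%:E)%E].

End Lattice.

Arguments lattice R {d}.

Section Uniqueness.
Variables (R : realType) (V : choiceType) (E : pred {fset V}).

Let open_set (F : {fset edge E}) : set (config E) :=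
  [set w | forall e, e \in F -> w e].

Let measurable_open_set F : measurable (open_set F).
Proof.
have -> : open_set F = \bigcap_(e in [set` F]) (edge_open e).
  by apply/seteqP; split=> w h e; exact: h.
apply: fin_bigcap_measurable => // e _.
by apply: sub_sigma_algebra; exists e.
Qed.

Lemma bernoulli_percolation_unique (p : R) (P Q : probability (config E) R) :
  bernoulli_percolation p P -> bernoulli_percolation p Q ->
  forall A, measurable A -> P A = Q A.
Proof.
move=> hP hQ A mA.
apply: (@measure_unique _ _ _ (range open_set) (fun=> setT)) => //.
- apply/seteqP; split; apply: smallest_sub; try exact: smallest_sigma_algebra.
  + move=> _ [e _ <-]; apply: sub_sigma_algebra; exists [fset e]%fset => //.
    apply/seteqP; split=> w /=; first by apply; rewrite inE.
    by move=> we e'; rewrite inE => /eqP ->.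
  + by move=> _ [F _ <-]; exact: measurable_open_set.
- move=> _ _ [F _ <-] [G _ <-]; exists (F `|` G)%fset => //.
  apply/seteqP; split=> w /=.
    by move=> h; split=> e eF; apply: h; rewrite in_fsetU eF ?orbT.
  by move=> [h1 h2] e; rewrite in_fsetU => /orP[/h1|/h2].
- by move=> _; exists fset0 => //; apply/seteqP; split=> w.
- by rewrite bigcup_const.
- by move=> _ [F _ <-]; exact: etrans (hP F) (esym (hQ F)).
- by move=> _; rewrite (le_lt_trans (probability_le1 _ _)) ?ltry.
Qed.

End Uniqueness.

Section Existence.
Variables (R : realType) (p : R).
Hypothesis p01 : 0 <= p <= 1.

(* The digits of a uniform u in [0, 1[, in the expansion that splits intervals
   in proportion p : 1 - p, are independent and equal true with probability p. *)
Let shift (u : R) : R := if u < p then u / p else (u - p) / (1 - p).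

Let digit (n : nat) (u : R) : bool := iter n shift u < p.

Let agree (o : seq (option bool)) (u : R) : Prop :=
  forall i b, (i < size o)%N -> nth None o i = Some b -> digit i u = b.

Let w (o : seq (option bool)) : R :=
  \prod_(x <- o) (if x is Some b then if b then p else 1 - p else 1).

Let D : set R := `[0, 1[%classic.

Let shift01 u : D u -> D (shift u).
Proof.
move: p01 => /andP[p0 p1]; rewrite /D /shift/= !in_itv/= => /andP[u0 u1].
case: ltP => up.
  have pp : 0 < p by exact: le_lt_trans up.
  by rewrite divr_ge0//= ltr_pdivrMr// mul1r.
have pp : 0 < 1 - p by rewrite subr_gt0 (le_lt_trans up).
by rewrite divr_ge0 ?subr_ge0//= ltr_pdivrMr// mul1r ltrD2r.
Qed.

Let agree_cons x o u : agree (x :: o) u <->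
  (forall b, x = Some b -> (u < p) = b) /\ agree o (shift u).
Proof.
split=> [h|[h1 h2] [|i] b].
- split=> [b xb|i b io ob]; first by have := h 0%N b isT xb.
  by have := h i.+1 b io ob; rewrite /digit iterSr.
- by move=> _ /h1.
- by move=> io ob; rewrite /digit iterSr; exact: h2.
Qed.

Let agree_itv (s : seq bool) : exists l, [/\ 0 <= l, l + w (map Some s) <= 1,
  0 <= w (map Some s) &
  forall u, D u -> agree (map Some s) u <-> l <= u < l + w (map Some s)].
Proof.
case/andP: (p01) => p0 p1.
elim: s => [|b s [l [l0 l1 w0 ih]]].
  by exists 0; rewrite /w/= big_nil add0r lexx ler01; split.
have wE : w (map Some (b :: s)) = (if b then p else 1 - p) * w (map Some s).
  by rewrite /w/= big_cons.
rewrite wE; set W := w _ in l1 w0 ih *.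
have q0 : 0 <= 1 - p by rewrite subr_ge0.
exists (if b then p * l else p + (1 - p) * l).
have key u : D u -> agree (map Some (b :: s)) u <->
    (u < p) = b /\ (l <= shift u < l + W).
  move=> Du; split.
    move=> /agree_cons[/(_ b erefl) -> h]; split=> //.
    exact: (proj1 (ih _ (shift01 Du)) h).
  move=> [ub h]; apply/agree_cons; split=> [c [<-]//|].
  exact: (proj2 (ih _ (shift01 Du)) h).
case: b {wE} key => key; split.
- exact: mulr_ge0.
- by rewrite -mulrDr mulr_ile1// addr_ge0.
- exact: mulr_ge0.
- move=> u Du; move: (Du); rewrite /D/= in_itv/= => /andP[u0 u1].
  rewrite -mulrDr; split.
    move/key => /(_ Du)[up]; rewrite /shift up.
    have pp : 0 < p by exact: le_lt_trans up.
    by rewrite ler_pdivlMr// ltr_pdivrMr// ![_ * p]mulrC.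
  move=> /andP[h1 h2]; apply/key => //.
  have up : u < p.
    by rewrite (lt_le_trans h2)// ler_piMr.
  have pp : 0 < p by exact: le_lt_trans up.
  by rewrite /shift up ler_pdivlMr// ltr_pdivrMr// ![_ * p]mulrC h1 h2.
- by rewrite addr_ge0// mulr_ge0.
- rewrite -addrA -mulrDr -lerBrDl; exact: ler_piMr.
- exact: mulr_ge0.
- move=> u Du; move: (Du); rewrite /D/= in_itv/= => /andP[u0 u1].
  rewrite -addrA -mulrDr -lerBrDl -ltrBlDl; split.
    move/key => /(_ Du)[up]; rewrite /shift up.
    have pp : 0 < 1 - p.
      by rewrite subr_gt0 (le_lt_trans _ u1)// leNgt up.
    by rewrite ler_pdivlMr// ltr_pdivrMr// ![_ * (1 - p)]mulrC.
  move=> /andP[h1 h2]; apply/key => //.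
  have pu : p <= u.
    by rewrite -subr_ge0 (le_trans _ h1)// mulr_ge0.
  have pp : 0 < 1 - p by rewrite subr_gt0 (le_lt_trans pu).
  rewrite /shift ltNge pu/=; split=> //.
  by rewrite ler_pdivlMr// ltr_pdivrMr// ![_ * (1 - p)]mulrC h1 h2.
Qed.

Let agree_None s o u : agree (map Some s ++ None :: o) u <->
  agree (map Some (rcons s true) ++ o) u \/
  agree (map Some (rcons s false) ++ o) u.
Proof.
elim: s u => [|c s ih] u /=.
  split.
    move=> /agree_cons[_ h].
    case: (boolP (u < p)) => up; [left|right]; apply/agree_cons; split=> //.
      by move=> b [<-].
    by move=> b [<-]; exact/negbTE.
  by case=> /agree_cons[_ h]; apply/agree_cons.
split.
  by move=> /agree_cons[h /ih[]h']; [left|right]; apply/agree_cons.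
case=> /agree_cons[h h']; apply/agree_cons; split=> //; apply/ih.
  by left.
by right.
Qed.

Let agree_disj s o u : agree (map Some (rcons s true) ++ o) u ->
  agree (map Some (rcons s false) ++ o) u -> False.
Proof.
elim: s u => [|c s ih] u /=.
  move=> /agree_cons[/(_ _ erefl) h _] /agree_cons[/(_ _ erefl)].
  by rewrite h.
by move=> /agree_cons[_ h1] /agree_cons[_ h2]; exact: ih h1 h2.
Qed.

Let agree_measure s o :
  measurable (D `&` agree (map Some s ++ o)) /\
  lebesgue_measure (D `&` agree (map Some s ++ o)) = (w (map Some s ++ o))%:E.
Proof.
elim: o s => [|[b|] o ih] s.
- rewrite cats0; have [l [l0 l1 w0 h]] := agree_itv s.
  have -> : D `&` agree (map Some s) =
      `[l, l + w (map Some s)[%classic.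
    apply/seteqP; split=> u /=; rewrite in_itv/=.
      by move=> [Du /(h _ Du)].
    move=> lu; have Du : D u.
      case/andP: lu => lu ul; rewrite /D/= in_itv/= (le_trans l0 lu)/=.
      exact: lt_le_trans ul l1.
    by split=> //; apply/h.
  split; first exact: measurable_itv.
  rewrite lebesgue_measure_itv/= lte_fin ltrDl; case: ltP => [_|w0'].
    by rewrite -EFinB addrAC subrr add0r.
  by congr EFin; apply/eqP; rewrite eq_le w0 w0'.
- by have := ih (rcons s b); rewrite map_rcons cat_rcons.
- have [m1 e1] := ih (rcons s true); have [m2 e2] := ih (rcons s false).
  have -> : D `&` agree (map Some s ++ None :: o) =
     (D `&` agree (map Some (rcons s true) ++ o)) `|`
     (D `&` agree (map Some (rcons s false) ++ o)).
    rewrite -setIUr; congr (_ `&` _).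
    by apply/seteqP; split=> u /agree_None.
  split; first exact: measurableU.
  rewrite measureU//; last first.
    apply/seteqP; split=> // u [[_ h1] [_ h2]]; exact: agree_disj h1 h2.
  transitivity ((w (map Some (rcons s true) ++ o))%:E +
    (w (map Some (rcons s false) ++ o))%:E)%E; first by rewrite -e1 -e2.
  rewrite -EFinD /w !map_rcons !cat_rcons !big_cat/= !big_cons.
  by rewrite -mulrDr -mulrDl [p + _]addrC subrK.
Qed.

Let mD : measurable D.
Proof. exact: measurable_itv. Qed.

Let mu : {measure set (measurableTypeR R) -> \bar R} :=
  mrestr lebesgue_measure mD.

Let mu1 : mu setT = 1%:E.
Proof.
rewrite /mu /= /mrestr setTI lebesgue_measure_itv/=.
by rewrite lte_fin ltr01 oppr0 adde0.
Qed.

Variables (V : countType) (E : pred {fset V}).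

Let X (u : R) : config E := fun e : edge E => (0 <= u < 1) && digit (choice.pickle e) u.

Let mX : @measurable_fun _ _ (measurableTypeR R) (config E) setT X.
Proof.
apply: (@measurability _ _ _ _ setT X (range (@edge_open V E))) => //.
move=> _ [_ [e _ <-] <-]; rewrite setTI.
have -> : X @^-1` edge_open e =
    D `&` agree (map Some [::] ++ rcons (nseq (choice.pickle e) None) (Some true)).
  apply/seteqP; split=> u /=; rewrite /edge_open /X /D/= in_itv/=.
    move=> /andP[-> h]; split=> // i b; rewrite size_rcons size_nseq ltnS.
    rewrite nth_rcons size_nseq nth_nseq => ie.
    by case: ltngtP ie => // -> _ [<-].
  move=> [-> h] /=; apply: h; first by rewrite size_rcons size_nseq.
  by rewrite nth_rcons size_nseq ltnn eqxx.
by have [] := agree_measure [::] (rcons (nseq (choice.pickle e) None) (Some true)).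
Qed.

Lemma bernoulli_percolation_exists :
  exists P : probability (config E) R, bernoulli_percolation p P.
Proof.
pose Q : probability (measurableTypeR R) R :=
  HB.pack (Measure.sort mu) (Measure_isProbability.Build _ _ _ mu mu1).
pose Y := @mfun_Sub _ _ (measurableTypeR R) (config E) X (mem_set mX).
exists (distribution Q Y) => F.
rewrite /distribution /pushforward /= /mrestr.
pose r := map choice.pickle (enum_fset F).
pose N := (\max_(i <- r) i).+1.
pose o := mkseq (fun i => if i \in r then Some true else None) N.
have rN i : i \in r -> (i < N)%N by move=> ir; rewrite ltnS; exact: leq_bigmax_seq.
have -> : X @^-1` [set w : config E | forall e, e \in F -> w e] `&` D =
    D `&` agree (map Some [::] ++ o).
  rewrite setIC; apply/seteqP; split=> u /=; rewrite /X /D/= in_itv/=.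
    move=> [u01 h]; split=> // i b; rewrite size_mkseq => iN.
    rewrite nth_mkseq//; case: ifPn => // /mapP[e eF ->] [<-].
    by have := h e eF; rewrite u01.
  move=> [u01 h]; split=> // e eF; rewrite u01/=.
  have er : choice.pickle e \in r by exact: map_f.
  by apply: h; rewrite ?size_mkseq ?nth_mkseq ?er//; exact: rN.
have [_ ->] := agree_measure [::] o; congr EFin.
rewrite /w /o cat0s big_map (eq_bigr (fun i => if i \in r then p else 1)); last first.
  by move=> i _; case: ifP.
rewrite -big_mkcond big_const_seq iter_mulr_1; congr (_ ^+ _).
have -> : #|` F| = size r by rewrite size_map.
rewrite -size_filter; apply/perm_size/uniq_perm.
- exact/filter_uniq/iota_uniq.
- by rewrite map_inj_uniq ?fset_uniq//; exact: (pcan_inj choice.pickleK).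
- move=> i; rewrite mem_filter mem_iota add0n /=.
  by case: (boolP (i \in r)) => //= /rN.
Qed.

End Existence.

(* Main.v *)
(* Write G(r) = E|B(0,r)|. Exploring B(0,r) leaves the edges that do not touch it
   fresh, so G(r+1+k) <= G(r) + (G(r+1) - G(r)) G(k). If some sphere had mean size
   G(r+1) - G(r) < 1, then G would be bounded, whereas the two-point lower bound
   makes the sum of P(0 <-> x) infinite. Hence G(r) >= r.

   For survival one needs G(r) <= C r. Let x' = x + v. Summed over x and y, the
   probability that d(0,x) <= r and that x' is joined to y within r off B(0,n),
   n = 2r + O(1), is at least G(r)^2 - G(r)^2 T(v), where T(v) is an open triangle
   diagram; by Hoelder with exponents 3/2, T(v) is small for a suitable v as soon
   as P(0 <-> x)^(3/2) is summable, which is where d > 6 enters. Opening a path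
   from x to x' costs a constant factor and puts y in B(0,n), and the given pair
   (0,y) arises from O(n) values of x only. So G(r)^2 <= C r G(3r), and as G grows
   polynomially this forces G(r) <= C r. Finally the tree-graph bound
   E|B(0,k)|^2 <= G(k)^3 and the second moment method, for the number of vertices
   at distance between r and k = O(r), give P(H(r)) >= c/r. *)
Require Import Defs.
From mathcomp Require Import all_boot all_order all_algebra finmap.
From mathcomp Require Import all_classical all_reals all_analysis.
From mathcomp Require Import measurable_realfun zify ring lra.

Set Implicit Arguments.
Unset Strict Implicit.
Unset Printing Implicit Defensive.

Import Order.TTheory GRing.Theory Num.Theory.
Import numFieldNormedType.Exports.

Local Open Scope classical_set_scope.
Local Open Scope fset_scope.
Local Open Scope ring_scope.

(** * Finite product measures *)

(** Edges have bounded range, so every event about a fixed radius depends on finitely many edges.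
    Independence, finite energy and the BK inequality are therefore proved for finite products and
    transferred exactly to the percolation law; a limit in the radius is taken only to see that G is
    unbounded.

    The constants of the two-point estimate are arbitrary, so no diagram is small by itself: without
    the displacement v the triangle contains the degenerate term x = z = u, equal to A^3. This is
    the reason for working with x' = x + v. When v is long, the three sides of a triangle cannot all
    be short, and the smallness comes from the tail of a convergent sum. Since v depends on d and A
    but not on r, opening a path from x to x' costs a factor independent of r. *)

Section FiniteExpectation.
Variables (R : realType) (T : choiceType) (p : R).
Hypothesis p01 : 0 <= p <= 1.
Implicit Types (s : seq T) (w : {fset T}) (f g : {fset T} -> R)
  (A B : pred {fset T}).

(* The expectation of [f (w `|` S)] for a random set [S] that contains each
   element of the duplicate-free list [s] independently with probability [p];
   independence and the BK inequality are then inductions on [s]. *)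
Fixpoint Ex s f w : R :=
  if s is e :: s' then p * Ex s' f (e |` w) + (1 - p) * Ex s' f w else f w.

Lemma eq_Ex s f g w : f =1 g -> Ex s f w = Ex s g w.
Proof. by move=> fg; elim: s w => //= e s ih w; rewrite !ih. Qed.

Lemma Ex_le s f g w : (forall u, f u <= g u) -> Ex s f w <= Ex s g w.
Proof.
move=> fg; elim: s w => //= e s ih w; case/andP: p01 => p0 p1.
by rewrite lerD // ler_wpM2l ?subr_ge0.
Qed.

Lemma Ex_cst s c w : Ex s (fun=> c) w = c.
Proof. by elim: s w => //= e s ih w; rewrite !ih -mulrDl addrC subrK mul1r. Qed.

Lemma Ex_ge0 s f w : (forall u, 0 <= f u) -> 0 <= Ex s f w.
Proof. by move=> f0; rewrite -(Ex_cst s 0 w); apply: Ex_le. Qed.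

Lemma ExD s f g w : Ex s (fun u => f u + g u) w = Ex s f w + Ex s g w.
Proof. by elim: s w => //= e s ih w; rewrite !ih; ring. Qed.

Lemma ExZ s c f w : Ex s (fun u => c * f u) w = c * Ex s f w.
Proof. by elim: s w => //= e s ih w; rewrite !ih; ring. Qed.

Lemma ExZr s c f w : Ex s (fun u => f u * c) w = Ex s f w * c.
Proof. by elim: s w => //= e s ih w; rewrite !ih; ring. Qed.

Lemma ExB s f g w : Ex s (fun u => f u - g u) w = Ex s f w - Ex s g w.
Proof. by elim: s w => //= e s ih w; rewrite !ih; ring. Qed.

Lemma Ex_sum (I : Type) (r : seq I) (Q : pred I) s (F : I -> {fset T} -> R) w :
  Ex s (fun u => \sum_(i <- r | Q i) F i u) w = \sum_(i <- r | Q i) Ex s (F i) w.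
Proof.
elim: r => [|i r ih]; first by rewrite big_nil -[RHS](Ex_cst s 0 w);
  apply: eq_Ex => u; rewrite big_nil.
rewrite big_cons -ih; case: ifPn => Qi.
  by rewrite -ExD; apply: eq_Ex => u; rewrite big_cons Qi.
by apply: eq_Ex => u; rewrite big_cons (negbTE Qi).
Qed.

Lemma Ex_add s f e w : Ex s f (e |` w) = Ex s (fun u => f (e |` u)) w.
Proof. by elim: s w => //= e' s ih w; rewrite -!ih fsetUCA. Qed.

(** Keep only the branch in which [e] is sampled: it has weight [p], and there inserting [e] once
    more changes nothing. *)
Lemma Ex_finite_energy1 s f e w : (forall u, 0 <= f u) -> e \in s ->
  p * Ex s (fun u => f (e |` u)) w <= Ex s f w.
Proof.
move=> f0; case/andP: p01 => p0 p1; elim: s w => //= e' s ih w.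
rewrite inE; case: (eqVneq e e') => [<- _|_ /= es].
  rewrite -!Ex_add fsetUA fsetUid -mulrDl addrC subrK mul1r lerDl.
  by rewrite mulr_ge0 ?subr_ge0 ?Ex_ge0.
rewrite mulrDr mulrCA [p * ((1 - p) * _)]mulrCA.
by rewrite lerD // ler_wpM2l ?subr_ge0 ?ih.
Qed.

(** No monotonicity of [f] is asked: it will be applied to an event that involves a chosen path,
    which is not increasing. *)
Lemma Ex_finite_energy s f (r : seq T) w : (forall u, 0 <= f u) ->
  {subset r <= s} ->
  p ^+ size r * Ex s (fun u => f ([fset e in r] `|` u)) w <= Ex s f w.
Proof.
case/andP: p01 => p0 p1; elim: r f => [|e r ih] f f0 rs.
  rewrite expr0 mul1r; apply: Ex_le => u.
  by rewrite (_ : [fset e in [::]] = fset0) ?fset0U//; apply/fsetP => e; rewrite !inE.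
have es : e \in s by apply: rs; rewrite mem_head.
rewrite (le_trans _ (Ex_finite_energy1 _ f0 es))//= exprS -mulrA ler_wpM2l//.
have := ih (fun u => f (e |` u)) (fun=> f0 _).
rewrite /= => /(_ (fun x xr => rs x (mem_behead (s := e :: r) xr))).
apply: le_trans; rewrite ler_wpM2l ?exprn_ge0//; apply: Ex_le => u.
rewrite fsetUA le_eqVlt; apply/orP; left; apply/eqP; congr (f (_ `|` _)).
by apply/fsetP => x; rewrite !inE.
Qed.

(** Insertion is the only operation that [Ex] performs, so independence of a coordinate is phrased
    by insertion alone. *)
Definition ignores f e := forall u, f (e |` u) = f u.

(** At each coordinate one factor has equal branches, so the weights [p] and [1 - p] recombine on
    the other. *)
Lemma Ex_indep s f g w : (forall e, ignores f e \/ ignores g e) ->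
  Ex s (fun u => f u * g u) w = Ex s f w * Ex s g w.
Proof.
move=> fg; elim: s w => //= e s ih w; rewrite !ih; case: (fg e) => h.
- have -> : Ex s f (e |` w) = Ex s f w by rewrite Ex_add; apply: eq_Ex => u.
  by ring.
- have -> : Ex s g (e |` w) = Ex s g w by rewrite Ex_add; apply: eq_Ex => u.
  by ring.
Qed.

(* The strong Markov property at a random set [b u], discovered by revealing
   only the coordinates that the functions [g a] ignore. *)
Lemma Ex_strong_markov (I : choiceType) (D : {fset I}) (b : {fset T} -> I)
    s f (g : I -> {fset T} -> R) w :
  (forall u, b u \in D) ->
  (forall a e, ignores (fun u => f u * (b u == a)%:R) e \/ ignores (g a) e) ->
  Ex s (fun u => f u * g (b u) u) w =
  Ex s (fun u => f u * Ex s (g (b u)) w) w.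
Proof.
move=> bD fg.
have split (h : I -> {fset T} -> R) u :
    f u * h (b u) u = \sum_(a <- enum_fset D) (f u * (b u == a)%:R) * h a u.
  rewrite (bigD1_seq (b u)) ?fset_uniq//= eqxx mulr1 big1_seq ?addr0// => a.
  by case/andP=> ab _; rewrite eq_sym (negbTE ab) mulr0 mul0r.
rewrite (eq_Ex s w (split g)) (eq_Ex s w (split (fun a _ => Ex s (g a) w))).
rewrite !Ex_sum; apply: eq_bigr => a _.
by rewrite ExZr -Ex_indep//.
Qed.

Definition increasing (A : pred {fset T}) :=
  forall u v, u `<=` v -> A u -> A v.

(** For increasing events this is the usual disjoint occurrence: open coordinates suffice as
    witnesses, and [B] may use everything that [A] leaves over. *)
Definition disj_occ (A B : pred {fset T}) : pred {fset T} :=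
  fun u => `[< exists v, [/\ v `<=` u, A v & B (u `\` v)] >].

Definition Pr s (A : pred {fset T}) : R := Ex s (fun u => (A u)%:R) fset0.

Lemma disj_occ_increasing A B : increasing B -> increasing (disj_occ A B).
Proof.
move=> iB u v uv /asboolP[x [xu Ax Bx]]; apply/asboolP; exists x; split=> //.
  exact: fsubset_trans uv.
by apply: iB Bx; exact: fsetSD.
Qed.

Lemma Pr_ge0 s A : 0 <= Pr s A.
Proof. by apply: Ex_ge0. Qed.

Lemma Pr_le s A B : (forall u, A u -> B u) -> Pr s A <= Pr s B.
Proof.
move=> AB; apply: Ex_le => u; rewrite ler_nat.
by case Au: (A u); rewrite ?(AB _ Au).
Qed.

(* The van den Berg-Kesten inequality. In [X al be], the coordinates already
   treated have been split into independent copies, [al] for A, [be] for B. *)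
Lemma BK s A B : increasing A -> increasing B ->
  Pr s (disj_occ A B) <= Pr s A * Pr s B.
Proof.
move=> iA iB; case/andP: (p01) => p0 p1.
pose X (al be u : {fset T}) : bool :=
  `[< exists v, [/\ v `<=` u, A (al `|` v) & B (be `|` (u `\` v))] >].
pose a := fun u => (A u)%:R : R; pose b := fun u => (B u)%:R : R.
suff main : forall al be, Ex s (fun u => (X al be u)%:R) fset0 <= Ex s a al * Ex s b be.
  rewrite (le_trans _ (main fset0 fset0))//; apply: Pr_le => u.
  by move=> /asboolP[v [vu Av Bv]]; apply/asboolP; exists v; rewrite !fset0U.
have Xl e al be u : X al be u -> X (e |` al) be u.
  move=> /asboolP[v [vu Av Bv]]; apply/asboolP; exists v; split=> //.
  by apply: iA Av; rewrite -fsetUA fsubsetUr.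
have Xr e al be u : X al be u -> X al (e |` be) u.
  move=> /asboolP[v [vu Av Bv]]; apply/asboolP; exists v; split=> //.
  by apply: iB Bv; rewrite -fsetUA fsubsetUr.
(* A shared coordinate is used by at most one of the two events, so it can be handed to the private
   copy of that event. *)
have Xadd e al be u : X al be (e |` u) -> X (e |` al) be u \/ X al (e |` be) u.
  move=> /asboolP[v [vu Av Bv]]; case: (boolP (e \in v)) => ev; [left|right];
    apply/asboolP; [exists (v `\ e)|exists v]; split.
  - apply/fsubsetP => x; rewrite !inE => /andP[xe /(fsubsetP vu)].
    by rewrite !inE (negbTE xe).
  - apply: iA Av; apply/fsubsetP => x; rewrite !inE => /orP[->|->].
      by rewrite orbT.
    by case: (x == e); rewrite ?orbT.
  - apply: iB Bv; apply/fsubsetP => x; rewrite !inE.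
    case: (eqVneq x e) => [->|_] /=; first by rewrite ev orbF => ->.
    by [].
  - apply/fsubsetP => x xv; have := fsubsetP vu x xv; rewrite !inE.
    by case: (eqVneq x e) => [xe|//]; rewrite -xe xv in ev.
  - exact: Av.
  - apply: iB Bv; apply/fsubsetP => x; rewrite !inE.
    case/orP => [->|/andP[xv /orP[/eqP->|->]]]; rewrite ?orbT//.
    + by rewrite eqxx.
    + by rewrite xv !orbT.
elim: s => [|e s ih] al be /=.
  rewrite -natrM ler_nat mulnb; case Xab : X => //.
  have /asboolP[v [/fsubset_leq_card]] := Xab.
  rewrite cardfs0 leqn0 cardfs_eq0 => /eqP->; rewrite fsetD0 !fsetU0.
  by move=> -> ->.
rewrite Ex_add.
(* The shared coin for [e] is replaced by two independent coins. If the event occurs only thanks to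
   the shared [e], one mixed term is present along with the first one, and p^2 + p(1 - p) = p. *)
apply: (@le_trans _ _ (p ^+ 2 * Ex s (fun u => (X (e |` al) (e |` be) u)%:R) fset0 +
  p * (1 - p) * (Ex s (fun u => (X (e |` al) be u)%:R) fset0 +
   Ex s (fun u => (X al (e |` be) u)%:R) fset0) +
  (1 - p) ^+ 2 * Ex s (fun u => (X al be u)%:R) fset0)).
  rewrite -!ExZ -!ExD -!ExZ -!ExD; apply: Ex_le => u.
  have := Xadd e al be u; have := Xl e al be u; have := Xr e al be u.
  have := Xr e (e |` al) be u; have := Xl e al (e |` be) u.
  case: (X al be _); case: (X (e |` al) be _); case: (X al (e |` be) _);
    case: (X (e |` al) (e |` be) _); case: (X al be (e |` u)) => //=;
    move=> h1 h2 h3 h4 h5; try (by move: (h1 isT)); try (by move: (h2 isT));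
    try (by move: (h3 isT)); try (by move: (h4 isT));
    try (by case: (h5 isT)); rewrite ?mulr1n ?mulr0n; nra.
have h1 := ih (e |` al) (e |` be); have h2 := ih (e |` al) be.
have h3 := ih al (e |` be); have h4 := ih al be.
apply: (@le_trans _ _ (p ^+ 2 * (Ex s a (e |` al) * Ex s b (e |` be)) +
  p * (1 - p) * (Ex s a (e |` al) * Ex s b be + Ex s a al * Ex s b (e |` be)) +
  (1 - p) ^+ 2 * (Ex s a al * Ex s b be))).
  have q0 : 0 <= 1 - p by rewrite subr_ge0.
  apply: lerD; [apply: lerD|]; apply: ler_wpM2l; rewrite ?exprn_ge0 ?mulr_ge0//.
  exact: lerD.
by rewrite le_eqVlt; apply/orP; left; apply/eqP; ring.
Qed.

End FiniteExpectation.

(** * From the percolation law to finite products *)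

Section Cylinder.
Variables (R : realType) (V : choiceType) (E : pred {fset V}) (p : R).
Variable P : probability (config E) R.
Hypothesis hP : bernoulli_percolation p P.
Implicit Types (s r : seq (edge E)) (al : {fset edge E}).

Definition trace s (w : config E) : {fset edge E} := [fset e in s | w e].

Let O al r : set (config E) :=
  [set w : config E | (forall e, e \in al -> w e) /\ all (fun e => ~~ w e) r].

Let mO al r : measurable (O al r).
Proof.
elim: r => [|e r ih].
  have -> : O al [::] = \bigcap_(e in [set` al]) (edge_open e).
    by apply/seteqP; split=> w; [case=> h _ e; exact: h|move=> h; split=> // e; exact: h].
  apply: fin_bigcap_measurable => // e _.
  by apply: sub_sigma_algebra; exists e.
have -> : O al (e :: r) = (O al r `\` edge_open e)%classic.
  apply/seteqP; split=> w /=; first by case=> h /andP[/negP we hr].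
  by case=> [[h hr] /negP we]; split=> //=; rewrite we.
by apply: measurableD => //; apply: sub_sigma_algebra; exists e.
Qed.

(** The law is specified only on events that edges are open; closed edges are added one at a time,
    by subtracting the case where the edge is open. *)
Let PO al r : uniq r -> (forall e, e \in r -> e \notin al) ->
  P (O al r) = (p ^+ #|` al| * (1 - p) ^+ size r)%:E.
Proof.
elim: r al => [|e r ih] al /=.
  move=> _ _; rewrite mulr1 -hP; congr (P _).
  by apply/seteqP; split=> w; [case|split].
case/andP=> er ur h.
have e_al : e \notin al by apply: h; rewrite mem_head.
have h' x : x \in r -> x \notin al by move=> xr; apply: h; rewrite inE xr orbT.
have eqO : O al r = setU (O (e |` al) r) (O al (e :: r)).
  apply/seteqP; split=> w /=.
    move=> [h1 h2]; case we : (w e); [left|right]; split=> //=; last by rewrite we.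
    by move=> x; rewrite !inE => /orP[/eqP->//|/h1].
  move=> [] [h1 h2]; split=> //; last by case/andP: h2.
  by move=> x xal; apply: h1; rewrite !inE xal orbT.
have : P (O al r) = (P (O (e |` al) r) + P (O al (e :: r)))%E.
  rewrite {1}eqO measureU//; apply/seteqP; split=> // w [[h1 _] [_ /= /andP[we _]]].
  by move: we; rewrite h1// !inE eqxx.
rewrite ih// ih//; last first.
  move=> x xr; rewrite !inE negb_or (h' _ xr) andbT.
  by apply: contraNneq er => <-.
rewrite cardfsU1 e_al => /= /esym.
have /fineK <- : P (O al (e :: r)) \is a fin_num by exact: fin_num_measure.
move=> -[] /(congr1 (fun x => x - p ^+ (1 + #|` al|) * (1 - p) ^+ size r)).
by rewrite addrAC subrr add0r => ->; congr EFin; rewrite add1n !exprS; ring.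
Qed.

Lemma cylinder s (A : pred {fset edge E}) : uniq s ->
  measurable [set w | A (trace s w)] /\
  P [set w | A (trace s w)] = (Pr p s A)%:E.
Proof.
move=> us.
pose C al r s := setI (O al r) [set w | A (al `|` trace s w)].
(* The sets [al] and [r] hold the edges already revealed as open and closed; revealing one more edge
   of [s] is one step of the recursion of [Ex]. *)
suff main : forall al r, uniq r ->
    (forall e, e \in s -> e \notin al /\ e \notin r) ->
    (forall e, e \in r -> e \notin al) ->
    measurable (C al r s) /\
    P (C al r s) =
    (p ^+ #|` al| * (1 - p) ^+ size r * Ex p s (fun u => (A u)%:R) al)%:E.
  have := main fset0 [::] isT; rewrite !mul1r.
  have -> : C fset0 [::] s = [set w | A (trace s w)].
    by apply/seteqP; split=> w; rewrite /C/= fset0U; [case|split].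
  by apply.
elim: s us => [|e s ih] /=.
  move=> _ al r ur _ h; rewrite /C.
  have -> : [set w | A (al `|` trace [::] w)] = if A al then setT else set0.
    have t0 w : al `|` trace [::] w = al.
      by apply/fsetP => x; rewrite !inE orbF.
    by apply/seteqP; split=> w /=; rewrite t0; case: ifP.
  case: ifP => _; first by rewrite setIT PO// mulr1.
  by rewrite setI0 measure0 mulr0.
case/andP=> es us al r ur hs hr.
have eqC : C al r (e :: s) = setU (C (e |` al) r s) (C al (e :: r) s).
  apply/seteqP; split=> w /=.
    move=> [[h1 h2] h3]; case we : (w e); [left|right]; split.
    - by split=> // x; rewrite !inE => /orP[/eqP->//|/h1].
    - rewrite /=; move: h3; congr (is_true (A _)); apply/fsetP => x; rewrite !inE.
      by case: (eqVneq x e) => [->|_] /=; rewrite ?we ?orbT.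
    - by split=> //=; rewrite we.
    - rewrite /=; move: h3; congr (is_true (A _)); apply/fsetP => x; rewrite !inE.
      by case: (eqVneq x e) => [->|_] /=; rewrite ?we ?andbF ?orbF.
  move=> [] [[h1 h2] h3]; split.
  - by split=> // x xal; apply: h1; rewrite !inE xal orbT.
  - have we : w e by apply: h1; rewrite !inE eqxx.
    move: h3 => /=; congr (is_true (A _)); apply/fsetP => x; rewrite !inE.
    by case: (eqVneq x e) => [->|_] /=; rewrite ?we ?orbT.
  - by split=> //; case/andP: h2.
  - have /andP[/negbTE we _] := h2.
    move: h3 => /=; congr (is_true (A _)); apply/fsetP => x; rewrite !inE.
    by case: (eqVneq x e) => [->|_] /=; rewrite ?we ?andbF ?orbF.
have [e_al e_r] := hs e (mem_head _ _).
have hs' x : x \in s -> [/\ x \notin al, x \notin r & x != e].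
  move=> xs; have [] := hs x; first by rewrite inE xs orbT.
  by split=> //; apply: contraNneq es => <-.
have [m1 P1] : measurable (C (e |` al) r s) /\ P (C (e |` al) r s) =
    (p ^+ #|` e |` al| * (1 - p) ^+ size r * Ex p s (fun u => (A u)%:R) (e |` al))%:E.
  apply: ih => // x; first by move=> /hs'[? ? ?]; rewrite !inE negb_or; split=> //; apply/andP.
  move=> xr; rewrite !inE negb_or hr// andbT.
  by apply: contraNneq e_r => <-.
have [m2 P2] : measurable (C al (e :: r) s) /\ P (C al (e :: r) s) =
    (p ^+ #|` al| * (1 - p) ^+ (size r).+1 * Ex p s (fun u => (A u)%:R) al)%:E.
  apply: ih => // [|x|x]; first by rewrite /= e_r.
  - by move=> /hs'[? ? ?]; rewrite !inE negb_or; split=> //; apply/andP.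
  - by rewrite inE => /orP[/eqP->//|/hr].
split; first by rewrite eqC; exact: measurableU.
rewrite eqC measureU//; last first.
  apply/seteqP; split=> // w [[[h1 _] _] [[_ /= /andP[we _]] _]].
  by move: we; rewrite h1// !inE eqxx.
rewrite [X in (X + _)%E]P1 [X in (_ + X)%E]P2 cardfsU1 e_al add1n -EFinD.
by congr EFin; rewrite !exprS; ring.
Qed.

End Cylinder.

(** * Open paths *)

Section OpenPaths.
Variables (V : choiceType) (E : pred {fset V}).
Implicit Types (w : config E) (u : {fset edge E}) (x y z : V) (n m k : nat)
  (A : {fset V}) (s t : seq V).

(** Open distance at most [n], phrased without extended reals and as a Boolean, so that it can serve
    as an indicator. *)
Definition reach w n x y : bool :=
  `[< exists2 s, open_path w x y s & (size s <= n)%N >].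

Definition cfg u : config E := fun e => e \in u.

Lemma open_adjacentP w x y :
  reflect (exists2 e : edge E, w e & val e = [fset x; y]) (open_adjacent w x y).
Proof.
rewrite /open_adjacent; case: insubP => [e eE ve|nE] /=; apply: (iffP idP) => //.
- by move=> we; exists e.
- by move=> [e' we' ve']; rewrite (_ : e = e')//; apply: val_inj; exact: etrans ve (esym ve').
- by move=> [e _ ve]; case/negP: nE; move: (svalP e) => /=; rewrite -/(val e) ve.
Qed.

Lemma open_adjacent_sym w x y : open_adjacent w x y = open_adjacent w y x.
Proof. by rewrite /open_adjacent fsetUC. Qed.

Lemma open_adjacent_adjacent w x y : open_adjacent w x y -> Defs.adjacent E x y.
Proof. by move=> /open_adjacentP[e _ ve]; rewrite /Defs.adjacent -ve (svalP e). Qed.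

Lemma reachP w n x y :
  reflect (exists2 s, open_path w x y s & (size s <= n)%N) (reach w n x y).
Proof. exact: asboolP. Qed.

Lemma reach_refl w n x : reach w n x x.
Proof. by apply/reachP; exists [::]. Qed.

Lemma reach0 w x y : reach w 0 x y = (x == y).
Proof.
apply/idP/eqP => [/reachP[s [_ ls]]|->]; last exact: reach_refl.
by rewrite leqn0 size_eq0 => /eqP s0; rewrite -ls s0.
Qed.

Lemma reach_le w n m x y : (n <= m)%N -> reach w n x y -> reach w m x y.
Proof.
by move=> nm /reachP[s ps sn]; apply/reachP; exists s; rewrite ?(leq_trans sn).
Qed.

Lemma reach_sub w w' n x y : (forall e, w e -> w' e) ->
  reach w n x y -> reach w' n x y.
Proof.
move=> ww' /reachP[s [ps ls] sn]; apply/reachP; exists s => //; split=> //.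
apply: sub_path ps => a b /open_adjacentP[e we ve].
by apply/open_adjacentP; exists e => //; exact: ww'.
Qed.

Lemma reach_trans w n m x y z :
  reach w n x y -> reach w m y z -> reach w (n + m) x z.
Proof.
move=> /reachP[s [ps ls] sn] /reachP[t [pt lt] tm]; apply/reachP; exists (s ++ t).
  by split; rewrite ?cat_path ?last_cat ls ?ps.
by rewrite size_cat leq_add.
Qed.

Lemma reach1 w x y : open_adjacent w x y -> reach w 1 x y.
Proof. by move=> xy; apply/reachP; exists [:: y] => //; split=> //=; rewrite xy. Qed.

Lemma reachS w n x y : reach w n.+1 x y ->
  reach w n x y \/ exists2 z, reach w n x z & open_adjacent w z y.
Proof.
move=> /reachP[s]; elim/last_ind: s => [|s z _] [ps ls].
  by move=> _; left; apply/reachP; exists [::].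
rewrite size_rcons ltnS => sn; right; exists (last x s).
  by apply/reachP; exists s => //; split=> //; move: ps; rewrite rcons_path => /andP[].
by move: ps ls; rewrite rcons_path last_rcons => /andP[_ h] <-.
Qed.

Lemma reach_sym w n x y : reach w n x y = reach w n y x.
Proof.
suff h a b : reach w n a b -> reach w n b a by apply/idP/idP; exact: h.
elim: n a b => [|n ih] a b; first by rewrite !reach0 eq_sym.
move=> /reachS[/ih|[z /ih az zb]]; first exact: reach_le.
rewrite -add1n; apply: reach_trans az; apply: reach1.
by rewrite open_adjacent_sym.
Qed.

Lemma reach_uniq w n x y : reach w n x y ->
  exists s, [/\ path (open_adjacent w) x s, last x s = y, uniq (x :: s) &
    (size s <= n)%N].
Proof.
move=> /reachP[s [ps <-] sn]; case/shortenP: ps => s' ps' us' ss'.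
exists s'; split=> //; rewrite (leq_trans _ sn)//.
by apply: uniq_leq_size ss'; case/andP: us'.
Qed.

Lemma path_sub_last (e e' : rel V) x s :
  (forall a b, b \in s -> e a b -> e' a b) -> path e x s -> path e' x s.
Proof.
elim: s x => //= a s ih x h /andP[xa pa]; rewrite h ?mem_head//=.
by apply: ih => // b c cs; apply: h; rewrite inE cs orbT.
Qed.

Lemma path_sub_in (e e' : rel V) x s :
  (forall a b, a \in x :: s -> b \in s -> e a b -> e' a b) ->
  path e x s -> path e' x s.
Proof.
elim: s x => //= a s ih x h /andP[xa pa]; rewrite h ?mem_head//=.
by apply: ih => // b c bs cs; apply: h; rewrite inE ?bs ?cs orbT.
Qed.

Lemma last_visit (Q : pred V) x t : Q x ->
  exists t1 t2, [/\ t = t1 ++ t2, Q (last x t1) & all (predC Q) t2].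
Proof.
move=> Qx; elim/last_ind: t => [|t a [t1 [t2 [-> h1 h2]]]]; first by exists [::], [::].
case Qa : (Q a).
  by exists (rcons (t1 ++ t2) a), [::]; rewrite cats0 last_rcons.
by exists t1, (rcons t2 a); rewrite -rcons_cat all_rcons /= Qa.
Qed.

Lemma reach_increasing n x y : increasing (fun u => reach (cfg u) n x y).
Proof. by move=> u v uv; apply: reach_sub => e /(fsubsetP uv). Qed.

(** A convenient witness set for a path through [s]: it contains the edges of the path, and any open
    edge with an end off [s] is left over for the other event. *)
Definition inner u s : {fset edge E} :=
  [fset e in u | val e `<=` [fset a in s]].

Lemma inner_sub u s : inner u s `<=` u.
Proof. by apply/fsubsetP => e; rewrite !inE => /andP[]. Qed.

Lemma path_inner u x s : path (open_adjacent (cfg u)) x s ->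
  path (open_adjacent (cfg (inner u (x :: s)))) x s.
Proof.
apply: path_sub_in => a b ax bx /open_adjacentP[e eu ve].
apply/open_adjacentP; exists e => //; rewrite /cfg !inE; apply/andP; split=> //.
rewrite ve; apply/fsubsetP => z; rewrite !inE => /orP[]/eqP->.
  by rewrite inE in ax.
by rewrite bx orbT.
Qed.

Lemma notin_inner u s e : e \in u -> (exists2 a, a \in val e & a \notin s) ->
  e \in u `\` inner u s.
Proof.
move=> eu [a ae as']; rewrite !inE eu andbT /=; apply/negP => /fsubsetP /(_ a ae).
by rewrite !inE (negbTE as').
Qed.

(** Along a self-avoiding path, each edge of the second half ends at a vertex that the first half
    does not visit. *)
Lemma disj_occ_split u x s1 s2 :
  path (open_adjacent (cfg u)) x (s1 ++ s2) -> uniq (x :: s1 ++ s2) ->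
  disj_occ (fun v => reach (cfg v) (size s1) x (last x s1))
    (fun v => reach (cfg v) (size s2) (last x s1) (last x (s1 ++ s2))) u.
Proof.
rewrite cat_path => /andP[p1 p2] us; apply/asboolP; exists (inner u (x :: s1)).
split; first exact: inner_sub.
  by apply/reachP; exists s1 => //; split=> //; exact: path_inner.
apply/reachP; exists s2 => //; split; last by rewrite last_cat.
apply: path_sub_last p2 => a b bs2 /open_adjacentP[e eu ve].
apply/open_adjacentP; exists e => //; apply: notin_inner => //.
exists b; first by rewrite ve !inE eqxx orbT.
move: us; rewrite -cat_cons cat_uniq => /and3P[_ /hasPn h _].
exact: h.
Qed.

Lemma disj_occ_mono (A1 A2 B1 B2 : pred {fset edge E}) u :
  (forall v, A1 v -> A2 v) -> (forall v, B1 v -> B2 v) ->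
  disj_occ A1 B1 u -> disj_occ A2 B2 u.
Proof.
move=> hA hB /asboolP[v [vu /hA Av /hB Bv]]; apply/asboolP; by exists v.
Qed.

(** The branch point [v] is the last vertex that the path to [z] shares with a self-avoiding path to
    [y]; after [v], each edge of the former ends off the latter. *)
Lemma disj_occ_tree u n m x y z :
  reach (cfg u) n x y -> reach (cfg u) m x z ->
  exists2 v, reach (cfg u) n x v &
    disj_occ (disj_occ (fun a => reach (cfg a) n x v) (fun a => reach (cfg a) n v y))
      (fun a => reach (cfg a) m v z) u.
Proof.
move=> /reach_uniq[s [ps ls us sn]] /reachP[t [pt lt] tm].
have [t1 [t2 [tE Qt1 /allP ht2]]] := @last_visit (mem (x :: s)) x t (mem_head _ _).
move: Qt1; set v := last x t1 => /= vs; exists v.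
  case/splitPl: vs ps sn => s1 s2 ls1; rewrite cat_path size_cat => /andP[p1 _] sn.
  by apply/reachP; exists s1; [split|apply: leq_trans sn; exact: leq_addr].
apply/asboolP; exists (inner u (x :: s)); split; first exact: inner_sub.
  have := path_inner ps; set u' := inner _ _ => {}ps.
  case/splitPl: vs ps ls us sn => s1 s2 ls1 ps ls us sn.
  have := disj_occ_split ps us; rewrite ls1 ls.
  move: sn; rewrite size_cat => sn.
  apply: disj_occ_mono => a; apply: reach_le; apply: leq_trans sn.
    exact: leq_addr.
  exact: leq_addl.
apply/reachP; exists t2; last first.
  by apply: leq_trans tm; rewrite tE size_cat leq_addl.
split; last by rewrite -lt tE last_cat.
move: pt; rewrite tE cat_path => /andP[_].
apply: path_sub_last => a b bt /open_adjacentP[e eu ve].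
apply/open_adjacentP; exists e => //; apply: notin_inner => //.
exists b; first by rewrite ve !inE eqxx orbT.
exact: ht2.
Qed.

(** When [A] is an explored ball, the edges touching [A] are those that the exploration reveals;
    [off A] keeps the open edges among the fresh ones. *)
Definition off A u : {fset edge E} := [fset e in u | [disjoint val e & A]%fset].

Lemma off_sub A u : off A u `<=` u.
Proof. by apply/fsubsetP => e; rewrite !inE => /andP[]. Qed.

Lemma off_adjacent A u a b : a \notin A -> b \notin A ->
  open_adjacent (cfg u) a b -> open_adjacent (cfg (off A u)) a b.
Proof.
move=> aA bA /open_adjacentP[e eu ve]; apply/open_adjacentP; exists e => //.
rewrite /cfg !inE; apply/andP; split=> //; rewrite ve.
by apply/fdisjointP => z; rewrite !inE => /orP[]/eqP->.
Qed.

Lemma off_adjacent_notin A u a b : open_adjacent (cfg (off A u)) a b -> b \notin A.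
Proof.
move=> /open_adjacentP[e]; rewrite /cfg !inE => /andP[_ /fdisjointP h] ve.
by apply: h; rewrite ve !inE eqxx orbT.
Qed.

Lemma off_reach_notin A u k x y : x \notin A ->
  reach (cfg (off A u)) k x y -> y \notin A.
Proof.
move=> xA /reachP[s [ps <-] _]; elim/last_ind: s ps => // s a _.
rewrite rcons_path last_rcons => /andP[_]; exact: off_adjacent_notin.
Qed.

(** If a self-avoiding path meets [A], cut it at a vertex of [A]; otherwise all of its edges survive
    in [off A u]. *)
Lemma off_loss A u k x y : reach (cfg u) k x y ->
  (x \notin A) && reach (cfg (off A u)) k x y \/
  exists2 z, z \in A &
    disj_occ (fun a => reach (cfg a) k x z) (fun a => reach (cfg a) k z y) u.
Proof.
move=> /reach_uniq[s [ps ls us sk]].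
case: (boolP (has (mem A) (x :: s))) => [/hasP[z zs zA]|/hasPn h]; [right|left].
  exists z => //; case/splitPl: zs ps ls us sk => s1 s2 ls1 ps ls us sk.
  have := disj_occ_split ps us; rewrite ls1 ls.
  move: sk; rewrite size_cat => sk.
  apply: disj_occ_mono => a; apply: reach_le; apply: leq_trans sk.
    exact: leq_addr.
  exact: leq_addl.
have /= -> := h x (mem_head _ _); apply/reachP; exists s => //; split=> //.
apply: path_sub_in ps => a b ax bx; apply: off_adjacent; first exact: h.
by apply: h; rewrite inE bx orbT.
Qed.

Section Ball.
Variables (D : {fset V}) (n : nat) (x : V).

(** The set [D] only serves to make the ball a finite set; under [hD] nothing is cut off. *)
Definition rball u : {fset V} := [fset y in D | reach (cfg u) n x y].

Hypothesis hD : forall u y, reach (cfg u) n x y -> y \in D.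

Lemma in_rball u y : (y \in rball u) = reach (cfg u) n x y.
Proof. by rewrite !inE; apply/idP/idP => [/andP[]//|h]; rewrite h (hD h). Qed.

(** Each edge of a path of length at most n + 1 starts at distance at most n, hence touches the
    ball. This is why radius n + 1 is still determined by the exploration. *)
Let agree_reach u u' k y :
  (forall e : edge E, ~~ [disjoint val e & rball u]%fset -> e \in u -> e \in u') ->
  (k <= n.+1)%N -> reach (cfg u) k x y -> reach (cfg u') k x y.
Proof.
move=> h; elim: k y => [|k ih] y; first by rewrite !reach0.
move=> kn /reachS[yk|[z zk /open_adjacentP[e eu ve]]].
  by apply: (@reach_le _ k) => //; apply: ih => //; exact: ltnW.
rewrite -addn1; apply: reach_trans (ih z (ltnW kn) zk) _; apply: reach1.
apply/open_adjacentP; exists e => //; apply: h => //; rewrite ve.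
apply/negP => /fdisjointP/(_ z); rewrite !inE eqxx => /(_ isT).
have zn : reach (cfg u) n x z by apply: reach_le zk.
by rewrite zn (hD zn).
Qed.

(** The stopping-set property: when the ball equals [A], an edge away from [A] has not been
    examined, and distances up to n + 1 do not depend on it. The function [f] may read the distances
    at the levels n + 1, n and [k]. *)
Lemma rball_ignores A e k (f : {fset edge E} -> bool) : 
  [disjoint val e & A]%fset ->
  (forall u u', (forall y, reach (cfg u) n.+1 x y = reach (cfg u') n.+1 x y) ->
     (forall y, reach (cfg u) n x y = reach (cfg u') n x y) ->
     (forall y, reach (cfg u) k x y = reach (cfg u') k x y) -> f u = f u') ->
  (k <= n.+1)%N ->
  forall u, f (e |` u) && (rball (e |` u) == A) = f u && (rball u == A).
Proof.
move=> eA hf kn u.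
have main : rball (e |` u) == A \/ rball u == A ->
    forall j y, (j <= n.+1)%N -> reach (cfg (e |` u)) j x y = reach (cfg u) j x y.
  move=> hb j y jn; apply/idP/idP; last first.
    by apply: reach_sub => e'; rewrite /cfg !inE => ->; rewrite orbT.
  have au e' : ~~ [disjoint val e' & A]%fset -> e' \in e |` u -> e' \in u.
    by move=> h; rewrite !inE => /orP[/eqP ee|//]; rewrite ee eA in h.
  case: hb => /eqP hb; first by apply: agree_reach => // e'; rewrite hb; exact: au.
  (* Here it is the ball of [u] that equals [A], whereas [agree_reach] would require this of the
     ball of the configuration with [e] inserted. The induction shows that each vertex passed is
     already in the ball of [u]. *)
  elim: j y jn => [|j ih] y jn; first by rewrite !reach0.
  move=> /reachS[yk|[z zk /open_adjacentP[e' eu ve]]].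
    by apply: (@reach_le _ j) => //; apply: ih => //; exact: ltnW.
  rewrite -addn1; have zj := ih z (ltnW jn) zk; apply: reach_trans (zj) _.
  apply: reach1; apply/open_adjacentP; exists e' => //; apply: au => //; rewrite ve.
  apply/negP => /fdisjointP/(_ z); rewrite !inE eqxx => /(_ isT).
  by rewrite -hb in_rball (reach_le _ zj).
have bE : rball (e |` u) == A \/ rball u == A -> rball (e |` u) = rball u.
  by move=> hb; apply/fsetP => y; rewrite !in_rball main.
case: (boolP (rball u == A)) => bu.
  have hb : rball (e |` u) == A \/ rball u == A by right.
  rewrite (bE hb) bu !andbT; apply: hf => y; exact: main.
case: (boolP (rball (e |` u) == A)) => bu'; last by rewrite !andbF.
by move: bu; rewrite -bE ?bu'//; left.
Qed.

End Ball.

(** The vertex [z] comes right after the last visit to the ball. Reaching a vertex off the ball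
    takes at least r + 1 steps, so at most [k] of them remain. *)
Lemma reach_off_sphere u x r k y A :
  (forall z, (z \in A) = reach (cfg u) r x z) ->
  reach (cfg u) (r.+1 + k) x y ->
  y \in A \/ exists z, [/\ reach (cfg u) r.+1 x z, z \notin A &
     reach (cfg (off A u)) k z y].
Proof.
move=> hA; elim: k y => [|k ih] y.
  rewrite addn0 => yr; case: (boolP (y \in A)) => yA; [left|right] => //.
  by exists y; rewrite reach_refl.
rewrite addnS => /reachS[/ih[?|[z [h1 h2 h3]]]|[v /ih xv vy]].
- by left.
- by right; exists z; split=> //; exact: reach_le h3.
case: (boolP (y \in A)) => yA; [by left|right].
case: (boolP (v \in A)) => vA.
  exists y; rewrite reach_refl; split=> //.
  rewrite -addn1; apply: reach_trans (reach1 vy); by rewrite -hA.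
case: xv => [va|[z [h1 h2 h3]]]; first by rewrite va in vA.
exists z; split=> //; rewrite -addn1; apply: reach_trans h3 _; apply: reach1.
exact: off_adjacent.
Qed.

Definition edges_of x t : seq (edge E) :=
  pmap insub (pairmap (fun a b => [fset a; b]) x t).

Lemma size_edges_of x t : (size (edges_of x t) <= size t)%N.
Proof. by rewrite size_pmap_sub (leq_trans (count_size _ _))// size_pairmap. Qed.

Lemma mem_edges_of x t e : e \in edges_of x t ->
  exists a b, [/\ val e = [fset a; b], a \in x :: t & b \in x :: t].
Proof.
rewrite mem_pmap_sub; elim: t x => //= c t ih x; rewrite inE => /orP[/eqP ->|/ih].
  by exists x, c; rewrite !inE !eqxx !orbT.
by move=> [a [b [-> h1 h2]]]; exists a, b; rewrite !(in_cons x) h1 h2 !orbT.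
Qed.

Lemma path_edges_of x t u : path (Defs.adjacent E) x t ->
  {subset edges_of x t <= u} -> path (open_adjacent (cfg u)) x t.
Proof.
elim: t x => //= c t ih x /andP[xc pc] h.
have mem e : val e = [fset x; c] \/ e \in edges_of c t -> e \in edges_of x (c :: t).
  by rewrite !mem_pmap_sub /= in_cons => -[->|->]; rewrite ?eqxx ?orbT.
rewrite ih ?andbT//; last by move=> e ee; apply: h; apply: mem; right.
apply/open_adjacentP; exists (Sub [fset x; c] xc); last by rewrite SubK.
by apply: h; apply: mem; left; rewrite SubK.
Qed.

Lemma path_new_edge u x s (g : seq (edge E)) :
  path (open_adjacent (cfg ([fset e in g] `|` u))) x s ->
  ~~ path (open_adjacent (cfg u)) x s ->
  exists2 v, v \in x :: s & exists2 e, e \in g & v \in val e.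
Proof.
elim: s x => //= a s ih x /andP[xa pa]; rewrite negb_and => /orP[nxa|npa].
  case/open_adjacentP: xa => e; rewrite /cfg !inE => /orP[eg ve|eu ve].
    by exists x; rewrite ?mem_head//; exists e => //; rewrite ve !inE eqxx.
  by case/open_adjacentP: nxa; exists e.
have [v vs ve] := ih a pa npa; by exists v => //; rewrite inE vs orbT.
Qed.

End OpenPaths.

(** * Open distance and connections of bounded length *)

Section OpenDist.
Variables (R : realType) (V : choiceType) (E : pred {fset V}).
Implicit Types (w : config E) (x y : V) (n : nat).

(** Lengths are integers: an infimum at most n is below n + 1, so some path of length less than n +
    1 exists. *)
Lemma open_dist_le w x y n : (open_dist R w x y <= n%:R%:E)%E <-> reach w n x y.
Proof.
split=> [h|/reachP[s ps sn]]; last first.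
  rewrite (@le_trans _ _ (size s)%:R%:E) ?lee_fin ?ler_nat//.
  by apply: ereal_inf_lbound; exists s.
have lt : (open_dist R w x y < (n.+1)%:R%:E)%E.
  by rewrite (le_lt_trans h)// lte_fin ltr_nat.
have [_ [s ps <-]] := ereal_inf_lt lt; rewrite lte_fin ltr_nat ltnS => sn.
by apply/reachP; exists s.
Qed.

Lemma open_distS w x y n :
  open_dist R w x y = n.+1%:R%:E <-> reach w n.+1 x y /\ ~~ reach w n x y.
Proof.
split=> [h|[/open_dist_le h1 /negP h2]].
  split; first by apply/open_dist_le; rewrite h.
  by apply/negP => /open_dist_le; rewrite h lee_fin ler_nat ltnn.
apply/eqP; rewrite eq_le h1 /= leNgt; apply/negP => lt; apply: h2.
have [_ [s ps <-]] := ereal_inf_lt lt; rewrite lte_fin ltr_nat ltnS => sn.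
by apply/reachP; exists s.
Qed.
End OpenDist.
(** * Inequalities in finite volume *)

Section FiniteVolume.
Variables (R : realType) (V : choiceType) (E : pred {fset V}) (p : R).
Hypothesis p01 : 0 <= p <= 1.
Variable s : seq (edge E).
Implicit Types (u : {fset edge E}) (o x y z v : V) (n m k r : nat) (A D : {fset V}).

Definition conn n x y : R := Pr p s (fun u => reach (cfg u) n x y).

Lemma conn_ge0 n x y : 0 <= conn n x y.
Proof. exact: Pr_ge0. Qed.

Lemma conn_le n m x y : (n <= m)%N -> conn n x y <= conn m x y.
Proof. by move=> nm; apply: Pr_le => // u; exact: reach_le. Qed.

Lemma Pr_disj_occ_reach n m x y z v :
  Pr p s (disj_occ (fun u => reach (cfg u) n x y) (fun u => reach (cfg u) m z v)) <=
  conn n x y * conn m z v.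
Proof. by apply: BK => //; exact: reach_increasing. Qed.

Lemma natr_has_le (T : eqType) (r : seq T) (Q : pred T) :
  (has Q r)%:R <= \sum_(i <- r) (Q i)%:R :> R.
Proof.
elim: r => [|a r ih] /=; first by rewrite big_nil.
rewrite big_cons; case: (Q a) => /=; last by rewrite add0r.
by rewrite lerDl sumr_ge0.
Qed.

(** A union bound over the branch vertex [v], then the BK inequality twice. *)
Lemma tree_graph D n m x y z :
  (forall u v, reach (cfg u) n x v -> v \in D) ->
  Pr p s (fun u => reach (cfg u) n x y && reach (cfg u) m x z) <=
  \sum_(v <- D) conn n x v * (conn n v y * conn m v z).
Proof.
move=> hD.
pose B v : pred {fset edge E} :=
  disj_occ (disj_occ (fun a => reach (cfg a) n x v) (fun a => reach (cfg a) n v y))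
      (fun a => reach (cfg a) m v z).
apply: (@le_trans _ _ (\sum_(v <- D) Pr p s (B v))).
  rewrite -Ex_sum; apply: Ex_le => // u.
  apply: le_trans (natr_has_le _ _).
  rewrite ler_nat; case: andP => //= -[h1 h2].
  have [v xv Bv] := disj_occ_tree h1 h2.
  by rewrite lt0b; apply/hasP; exists v => //; exact: hD xv.
apply: ler_sum => v _; rewrite mulrA.
apply: (@le_trans _ _ (Pr p s (disj_occ (fun a => reach (cfg a) n x v)
  (fun a => reach (cfg a) n v y)) * conn m v z)).
  apply: BK => //; last exact: reach_increasing.
  by apply: disj_occ_increasing; exact: reach_increasing.
by apply: ler_wpM2r; [exact: conn_ge0|exact: Pr_disj_occ_reach].
Qed.

Section Markov.
Variables (D : {fset V}) (n : nat) (o : V).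
Hypothesis hD : forall u y, reach (cfg u) n o y -> y \in D.
Let b := @rball V E D n o.

(** The strong Markov property for the exploration of a ball: [f] is decided by distances up to n +
    1, while the second factor sees only edges away from the ball and can be sampled afresh. *)
Lemma markov_off k (f : {fset edge E} -> bool) (g : {fset V} -> bool) x j y :
  (forall u u', (forall y, reach (cfg u) n.+1 o y = reach (cfg u') n.+1 o y) ->
     (forall y, reach (cfg u) n o y = reach (cfg u') n o y) ->
     (forall y, reach (cfg u) k o y = reach (cfg u') k o y) -> f u = f u') ->
  (k <= n.+1)%N ->
  Ex p s (fun u => (f u)%:R * (g (b u) && reach (cfg (off (b u) u)) j x y)%:R) fset0 =
  Ex p s (fun u => (f u)%:R *
    Pr p s (fun u' => g (b u) && reach (cfg (off (b u) u')) j x y)) fset0.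
Proof.
move=> hf kn.
apply: (@Ex_strong_markov _ _ _ _ (fpowerset D) b s (fun u => (f u)%:R)
  (fun A u => (g A && reach (cfg (off A u)) j x y)%:R)).
  by move=> u; rewrite fpowersetE; apply/fsubsetP => z; rewrite !inE => /andP[].
move=> A e; case: (boolP [disjoint val e & A]%fset) => eA; [left|right] => u.
  by rewrite -!natrM !mulnb (rball_ignores hD eA hf kn).
have -> // : off A (e |` u) = off A u.
apply/fsetP => e'; rewrite !inE; case: (eqVneq e' e) => //= ->.
by rewrite (negbTE eA) !andbF.
Qed.

End Markov.

(** Sum over the vertex [z] at which the path leaves the ball for good. The difference
    [conn r.+1 o z - conn r o z] is the probability that [z] is at distance exactly r + 1, and
    forgetting that the rest of the path avoids the ball only increases its probability. *)
Lemma conn_sphere_decomp D r k o y :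
  (forall u z, reach (cfg u) r.+1 o z -> z \in D) ->
  conn (r.+1 + k) o y <= conn r o y +
    \sum_(z <- D) (conn r.+1 o z - conn r o z) * conn k z y.
Proof.
move=> hD.
have hD' u z : reach (cfg u) r o z -> z \in D.
  by move=> h; apply: (hD u); exact: reach_le h.
pose b := @rball V E D r o.
pose f z u := reach (cfg u) r.+1 o z && ~~ reach (cfg u) r o z.
apply: (@le_trans _ _ (Ex p s (fun u => (reach (cfg u) r o y)%:R +
   \sum_(z <- D) (f z u)%:R * (true && reach (cfg (off (b u) u)) k z y)%:R) fset0)).
  apply: Ex_le => // u; case h : (reach _ (r.+1 + k) _ _) => /=; last first.
    by rewrite addr_ge0// sumr_ge0// => z _; rewrite mulr_ge0.
  have hb z : (z \in b u) = reach (cfg u) r o z by exact: in_rball.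
  have [|[z [h1 h2 h3]]] := reach_off_sphere hb h.
    by rewrite hb => ->; rewrite lerDl sumr_ge0// => z _; rewrite mulr_ge0.
  rewrite hb in h2; rewrite -[leLHS]add0r lerD//.
  under eq_bigr => i _ do rewrite -natrM mulnb.
  apply: le_trans (natr_has_le _ _); rewrite ler_nat lt0b.
  by apply/hasP; exists z; [exact: hD h1|rewrite /f h1 h2].
rewrite ExD Ex_sum lerD2l; apply: ler_sum => z _.
rewrite (@markov_off D r o hD' r.+1 (f z) xpredT)//; last first.
  by move=> u u' h1 h2 h3; rewrite /f h1 h2.
have -> : conn r.+1 o z - conn r o z = Ex p s (fun u => (f z u)%:R) fset0.
  rewrite /conn /Pr -ExB; apply: eq_Ex => u; rewrite /f.
  case h : (reach _ r o z) => /=; last by rewrite andbT subr0.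
  by rewrite (reach_le _ h)// subrr andbF.
rewrite -ExZr; apply: Ex_le => // u; rewrite ler_wpM2l//.
apply: Pr_le => // u' /=; apply: reach_sub => e; exact: (fsubsetP (off_sub _ _)).
Qed.

(** The explored ball has the larger radius [n], so that [y] lies off it now but enters it once [x]
    and [x'] are joined. The condition on [x'] is separate because a path without edges does not
    feel [off]. *)
Definition far_pair D n r o x x' y : pred {fset edge E} := fun u =>
  reach (cfg u) r o x && ((x' \notin rball D n o u) &&
    reach (cfg (off (rball D n o u) u)) r x' y).

(** Given the ball, a connection from [x'] to [y] fails to be fresh only if it passes through some
    [z] of the ball, which the BK inequality bounds by a product. *)
Lemma far_pair_lb D n r o x x' y : (r <= n)%N ->
  (forall u z, reach (cfg u) n o z -> z \in D) ->
  conn r o x * conn r x' y -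
    \sum_(z <- D) Pr p s (fun u => reach (cfg u) r o x && reach (cfg u) n o z) *
       (conn r x' z * conn r z y)
  <= Pr p s (far_pair D n r o x x' y).
Proof.
move=> rn hD; pose b := @rball V E D n o.
pose g A := x' \notin A.
have -> : Pr p s (far_pair D n r o x x' y) =
  Ex p s (fun u => (reach (cfg u) r o x)%:R *
    (g (b u) && reach (cfg (off (b u) u)) r x' y)%:R) fset0.
  by apply: eq_Ex => u; rewrite /far_pair -natrM mulnb.
rewrite (@markov_off D n o hD r _ g)//; last exact: leqW.
under [X in _ - X]eq_bigr => i _ do rewrite -ExZr.
rewrite {1}/conn /Pr -Ex_sum -ExZr -ExB; apply: Ex_le => // u.
case h : (reach _ r o x) => /=; last first.
  by rewrite !mul0r sub0r big1 ?oppr0// => i _; rewrite mul0r.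
rewrite !mul1r lerBlDr.
pose loss z : pred {fset edge E} :=
  disj_occ (fun a => reach (cfg a) r x' z) (fun a => reach (cfg a) r z y).
apply: (@le_trans _ _ (Ex p s (fun u' =>
   (g (b u) && reach (cfg (off (b u) u')) r x' y)%:R +
    \sum_(z <- D) (reach (cfg u) n o z)%:R * (loss z u')%:R) fset0)).
  apply: Ex_le => // u'; case h' : (reach _ r x' y) => /=; last first.
    by rewrite addr_ge0// sumr_ge0// => z _; rewrite mulr_ge0.
  have [h1|[z zb hz]] := off_loss (b u) h'.
    by rewrite /g h1 lerDl sumr_ge0// => z _; rewrite mulr_ge0.
  rewrite -[leLHS]add0r lerD//.
  under eq_bigr => i _ do rewrite -natrM mulnb.
  apply: le_trans (natr_has_le _ _); rewrite ler_nat lt0b.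
  move: zb; rewrite in_rball// => zb.
  by apply/hasP; exists z; [exact: hD zb|rewrite /loss zb hz].
rewrite ExD Ex_sum lerD2l; apply: ler_sum => z _.
by rewrite ExZ ler_wpM2l//; exact: Pr_disj_occ_reach.
Qed.

(* Opening a path from [x] to [x'] joins [o] to [y]; as [o] and [y] were not
   joined before within distance [n], a chosen short path from [o] to [y] must
   visit the inserted one, which leaves few possibilities for [x]. *)
Lemma far_pair_ub D n m r o y (X : seq V) (sh : V -> V) (t : V -> seq V) M :
  (r + m + r <= n)%N ->
  (forall u z, reach (cfg u) n o z -> z \in D) ->
  (forall x, path (Defs.adjacent E) x (t x) /\ last x (t x) = sh x) ->
  (forall x, (size (t x) <= m)%N) ->
  (forall x, x \in X -> {subset edges_of E x (t x) <= s}) ->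
  (forall v, (count (fun x => v \in x :: t x) X <= M)%N) ->
  p ^+ m * \sum_(x <- X) Pr p s (far_pair D n r o x (sh x) y) <=
  (n.+1 * M)%:R * conn n o y.
Proof.
move=> rmn hD tP tm ts hM; case/andP: (p01) => p0 p1.
(* The path depends on the configuration alone, so a single path serves all [x] at once; the count
   of possible [x] rests on this. The default [[::]] occurs only when [o] and [y] are not joined
   within [n]. *)
pose pi u : seq V := xget [::] [set q | open_path (cfg u) o y q /\ (size q <= n)%N].
have piP u : reach (cfg u) n o y ->
    open_path (cfg u) o y (pi u) /\ (size (pi u) <= n)%N.
  move=> /reachP[q pq qn].
  have := @xgetI _ [::] [set q | open_path (cfg u) o y q /\ (size q <= n)%N] q.
  by apply; split.
pose H x u := reach (cfg u) n o y && has (fun v => v \in x :: t x) (o :: pi u).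
have step x : x \in X -> p ^+ m * Pr p s (far_pair D n r o x (sh x) y) <= Pr p s (H x).
  move=> xX; pose g := edges_of E x (t x).
  have gm : (size g <= m)%N := leq_trans (size_edges_of E x (t x)) (tm x).
  apply: (@le_trans _ _ (p ^+ size g * Pr p s (far_pair D n r o x (sh x) y))).
    by rewrite ler_wpM2r ?Pr_ge0// ler_wiXn2l.
  have := @Ex_finite_energy R _ p p01 s (fun u => (H x u)%:R) g fset0
    (fun u => ler0n _ _) (ts _ xX).
  apply: le_trans; rewrite ler_wpM2l ?exprn_ge0//; apply: Ex_le => // u.
  case: (boolP (far_pair _ _ _ _ _ _ _ u)) => //.
  rewrite /far_pair => /andP[ox /andP[x'b x'y]]; rewrite ler_nat lt0b.
  have yb := off_reach_notin x'b x'y.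
  rewrite in_rball// in yb.
  have sub e : cfg u e -> cfg ([fset e in g] `|` u) e.
    by rewrite /cfg !inE => ->; rewrite orbT.
  have [pt lt] := tP x.
  have oy : reach (cfg ([fset e in g] `|` u)) n o y.
    apply: reach_le rmn _; apply: reach_trans (reach_sub _ x'y); last first.
      by move=> e /(fsubsetP (off_sub _ _)); exact: sub.
    apply: reach_trans (reach_sub sub ox) _; apply/reachP; exists (t x) => //.
    split=> //; apply: path_edges_of => // e eg.
    by rewrite !inE -/g eg.
  rewrite /H oy /=; have [[p1' l1] s1] := piP _ oy.
  (* A chosen path free of inserted edges would be open in [u] already and put [y] in the ball,
     against [yb]. *)
  have [|v vpi [e eg ve]] := path_new_edge p1'.
    apply: contra yb => pu; apply/reachP.
    by exists (pi ([fset e in g] `|` u)).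
  apply/(@hasP _ _ (o :: _)); exists v => //.
  have [a [c [veq ax cx]]] := mem_edges_of eg.
  by move: ve; rewrite veq !inE => /orP[]/eqP->.
rewrite mulr_sumr big_seq; apply: le_trans (ler_sum _ step) _.
rewrite -big_seq -Ex_sum -ExZ; apply: Ex_le => // u.
rewrite /H; case h : (reach _ n o y); last first.
  by rewrite mulr0 big1.
rewrite mulr1; have [_ sn] := piP _ h.
apply: (@le_trans _ _ (\sum_(x <- X) \sum_(v <- o :: pi u) (v \in x :: t x)%:R)).
  by apply: ler_sum => x _; exact: natr_has_le.
rewrite exchange_big /=.
(* The path has at most n + 1 vertices, and each lies on at most [M] of the inserted paths. *)
apply: (@le_trans _ _ (\sum_(v <- o :: pi u) M%:R)).
  apply: ler_sum => v _; rewrite -natr_sum ler_nat (leq_trans _ (hM v))//.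
  by rewrite -sum1_count [X in (_ <= X)%N]big_mkcond.
by rewrite big_const_seq count_predT iter_addr_0 /= -mulrnA ler_nat mulnC leq_mul.
Qed.

(** A linear form of the second moment inequality: where [f] does not vanish, 2 f <= t + f^2 / t.
    The parameter is optimised by the caller. *)
Lemma Ex_le_AMGM (f : {fset edge E} -> R) (tt : R) : 0 < tt -> (forall u, 0 <= f u) ->
  2 * Ex p s f fset0 <= tt * Pr p s (fun u => f u != 0) +
     tt^-1 * Ex p s (fun u => f u ^+ 2) fset0.
Proof.
move=> t0 f0; rewrite -!ExZ -ExD; apply: Ex_le => // u /=.
have [->|fn0] := eqVneq (f u) 0; first by rewrite expr0n/= !mulr0 addr0.
rewrite mulr1 -subr_ge0.
have -> : tt + tt^-1 * f u ^+ 2 - 2 * f u = tt^-1 * (f u - tt) ^+ 2.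
  by field; rewrite gt_eqF.
by rewrite mulr_ge0 ?invr_ge0 ?sqr_ge0// ltW.
Qed.

End FiniteVolume.

(** * The lattice *)

Section Boxes.
Variable d : nat.
Local Notation V := 'rV[int]_d.
Implicit Types (x y z : V) (N : nat).

(** Balls of this norm are boxes of known cardinality; it differs from the Euclidean norm by a
    factor at most [d]. *)
Definition supnorm x : nat := \max_i `|x ord0 i|%N.

Lemma supnorm_le x N : (supnorm x <= N)%N = [forall i, `|x ord0 i| <= N]%N.
Proof. by apply/bigmax_leqP/forallP => h i; [exact: h|move=> _; exact: h]. Qed.

Lemma supnormD x y : (supnorm (x + y) <= supnorm x + supnorm y)%N.
Proof.
rewrite supnorm_le; apply/forallP => i; rewrite mxE.
have h z : (`|z ord0 i| <= supnorm z)%N.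
  exact: (@leq_bigmax _ (fun i => `|z ord0 i|%N) i).
have := h x; have := h y.
move: (x ord0 i) (y ord0 i) (supnorm x) (supnorm y) => a b m n.
lia.
Qed.

Lemma supnormN x : supnorm (- x) = supnorm x.
Proof. by apply: eq_bigr => i _; rewrite mxE abszN. Qed.

Lemma supnorm0 : supnorm 0 = 0%N.
Proof. by apply/eqP; rewrite -leqn0 supnorm_le; apply/forallP => i; rewrite mxE. Qed.

Let box_pt N (f : {ffun 'I_d -> 'I_(2 * N).+1}) : V :=
  \row_i ((f i : nat)%:Z - N%:Z).

Definition box N : {fset V} :=
  [fset box_pt f | f in {: {ffun 'I_d -> 'I_(2 * N).+1}}]%fset.

Lemma in_box N x : (x \in box N) = (supnorm x <= N)%N.
Proof.
rewrite supnorm_le; apply/imfsetP/forallP => /= [[f _ ->] i|h].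
  by rewrite mxE; have := ltn_ord (f i); lia.
exists [ffun i => inord (absz (x ord0 i + N%:Z))] => //.
apply/rowP => i; rewrite mxE ffunE inordK; have := h i; move: (x ord0 i) => a; lia.
Qed.

Lemma card_box N : #|` box N| = ((2 * N).+1 ^ d)%N.
Proof.
rewrite card_imfset/=; last first.
  move=> f g fg; apply/ffunP => i; apply/val_inj.
  by have := congr1 (fun x : V => x 0 i) fg; rewrite !mxE => /addIr [].
by rewrite -cardE card_ffun !card_ord.
Qed.

Lemma supnormB_le x y m : (supnorm (y - x) <= m)%N -> (supnorm y <= supnorm x + m)%N.
Proof.
move=> h; rewrite -(subrK x y) addrC (leq_trans (supnormD _ _))//.
by rewrite leq_add2l.
Qed.

End Boxes.

Section Norms.
Variables (R : realType) (d : nat).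
Implicit Types (x : 'rV[int]_d) (n : nat).

Lemma coord_le_norm x i : (`|x ord0 i|%N)%:R <= euclid_norm R x.
Proof.
rewrite /euclid_norm -(@ger0_norm _ (`|x ord0 i|%N)%:R)// -sqrtr_sqr ler_wsqrtr//.
rewrite natr_absz intr_norm real_normK ?num_real//.
by rewrite (bigD1 i)//= lerDl sumr_ge0// => j _; exact: sqr_ge0.
Qed.

Lemma supnorm_le_norm x : (supnorm x)%:R <= euclid_norm R x.
Proof.
apply: (big_ind (fun m => m%:R <= euclid_norm R x)) => [|a b|i _].
- exact: sqrtr_ge0.
- by rewrite /maxn; case: ifP.
- exact: coord_le_norm.
Qed.

Lemma norm_le_supnorm x : euclid_norm R x <= (d * supnorm x)%:R.
Proof.
have dd : (d <= d * d)%N by case: (d) => // k; nia.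
rewrite -(ger0_norm (ler0n R (d * supnorm x))) -sqrtr_sqr ler_wsqrtr//.
apply: (@le_trans _ _ (\sum_(i < d) (supnorm x)%:R ^+ 2)).
  apply: ler_sum => i _; rewrite -[leLHS]real_normK ?num_real// -intr_norm -natr_absz.
  rewrite lerXn2r ?nnegrE// ler_nat.
  exact: (@leq_bigmax _ (fun i => `|x ord0 i|%N) i).
by rewrite sumr_const card_ord -!natrX -mulrnA ler_nat expnMn mulnC leq_mul2r -[(d ^ 2)%N]mulnn dd orbT.
Qed.

Lemma norm_powE x : (2 <= d)%N -> x != 0 ->
  norm_pow R x = (euclid_norm R x ^+ (d - 2))^-1.
Proof.
move=> d2 x0; rewrite /norm_pow (negbTE x0) exprnN; congr (_ ^ _).
by rewrite -subzn// opprB.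
Qed.

Lemma norm_pow_ge0 x : 0 <= norm_pow R x.
Proof. by rewrite /norm_pow; case: ifP => // _; rewrite exprz_ge0// sqrtr_ge0. Qed.

Lemma norm_powN x : norm_pow R (- x) = norm_pow R x.
Proof.
rewrite /norm_pow oppr_eq0; case: ifP => // _; congr (_ ^ _); congr Num.sqrt.
by apply: eq_bigr => i _; rewrite mxE rmorphN sqrrN.
Qed.

Lemma supnorm_eq0 x : (supnorm x == 0%N) = (x == 0).
Proof.
apply/eqP/eqP => [x0|->]; last exact: supnorm0.
apply/rowP => i; rewrite mxE; apply/eqP; rewrite -absz_eq0 -leqn0.
apply: leq_trans (_ : supnorm x <= 0)%N; last by rewrite x0.
exact: (@leq_bigmax _ (fun i => `|x ord0 i|%N) i).
Qed.

Lemma norm_pow_lb n x : (2 <= d)%N -> (0 < n)%N -> (supnorm x <= n)%N ->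
  ((d * n)%:R ^+ (d - 2))^-1 <= norm_pow R x.
Proof.
move=> d2 n0 xn.
have dn : 0 < (d * n)%:R :> R by rewrite ltr0n muln_gt0 n0 andbT; exact: leq_trans d2.
case: (eqVneq x 0) => [->|x0].
  rewrite /norm_pow eqxx invf_le1 ?exprn_gt0// exprn_ege1// ler1n muln_gt0 n0 andbT.
  exact: leq_trans d2.
have s0 : 0 < euclid_norm R x.
  by apply: lt_le_trans (supnorm_le_norm x); rewrite ltr0n lt0n supnorm_eq0.
rewrite norm_powE// lef_pV2 ?posrE ?exprn_gt0// lerXn2r ?nnegrE ?(ltW s0) ?(ltW dn)//.
by apply: (le_trans (norm_le_supnorm x)); rewrite ler_nat leq_mul2l xn orbT.
Qed.

Lemma norm_pow_ub n x : (2 <= d)%N -> (0 < n)%N -> (n <= supnorm x)%N ->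
  norm_pow R x <= (n%:R ^+ (d - 2))^-1.
Proof.
move=> d2 n0 nx.
have x0 : x != 0 by rewrite -supnorm_eq0 -lt0n (leq_trans n0).
have nx' : n%:R <= euclid_norm R x.
  by apply: (le_trans _ (supnorm_le_norm x)); rewrite ler_nat.
have n0' : 0 < n%:R :> R by rewrite ltr0n.
have s0 := lt_le_trans n0' nx'.
by rewrite norm_powE// lef_pV2 ?posrE ?exprn_gt0// lerXn2r ?nnegrE ?(ltW s0) ?(ltW n0').
Qed.

End Norms.

(** * The open triangle *)

Section BoundedSums.
Variables (R : realType) (V : choiceType).
Implicit Types (K : V -> R) (M : R) (D : {fset V}).

(** For nonnegative [K] this is summability with total at most [M], kept at the level of finite
    sums. *)
Definition sums_le K M := forall D, \sum_(x <- D) K x <= M.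

Lemma sums_le_ge0 K M : sums_le K M -> 0 <= M.
Proof. by move=> h; have := h fset0; rewrite big_seq_fset0. Qed.

Lemma sums_le_inj K M (phi : V -> V) : injective phi -> sums_le K M ->
  sums_le (K \o phi) M.
Proof.
move=> inj h D; have := h [fset phi x | x in D]%fset.
by rewrite big_imfset//= => a b _ _; exact: inj.
Qed.

(** The set [S] nearly attains the supremum of all finite sums; a finite set disjoint from it cannot
    add more than [e]. *)
Lemma sums_le_tail K M (e : R) : sums_le K M -> 0 < e ->
  exists S : {fset V}, sums_le (fun x => if x \in S then 0 else K x) e.
Proof.
move=> hM e0; pose S := [set z | exists D : {fset V}, z = \sum_(x <- D) K x].
have hS : has_sup S.
  by split; [exists 0, fset0; rewrite big_seq_fset0|exists M => _ [D ->]; exact: hM].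
have [_ [D0 ->] hD0] := sup_adherent e0 hS; exists D0 => D.
rewrite (big_fsetID _ (mem D0)) /= big1_seq ?add0r; last first.
  by move=> x; rewrite !inE => /andP[_ /andP[_ ->]].
set D' := [fset x in D | x \notin D0]%fset.
have -> : \sum_(x <- D') (if x \in D0 then 0 else K x) = \sum_(x <- D') K x.
  rewrite big_seq [RHS]big_seq; apply: eq_bigr => x; rewrite !inE.
  by move=> /andP[_ /negbTE->].
have : \sum_(x <- (D0 `|` D')) K x <= sup S.
  by apply: sup_upper_bound => //; exists (D0 `|` D').
rewrite (big_fsetID _ (mem D0)) /=.
have -> : [fset x | x in D0 `|` D' & x \in D0]%fset = D0.
  by apply/fsetP => x; rewrite !inE; case: (x \in D0); rewrite ?andbF ?orbT.
have -> : [fset x | x in D0 `|` D' & x \notin D0]%fset = D'.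
  by apply/fsetP => x; rewrite !inE; case: (x \in D0); rewrite ?andbF ?orbF ?andbT.
by move=> h; rewrite -lerBrDl in h; apply: (le_trans h); rewrite lerBlDl -lerBlDr ltW.
Qed.

Lemma ler_sum_fsubset K D1 D2 : D1 `<=` D2 -> (forall x, 0 <= K x) ->
  \sum_(x <- D1) K x <= \sum_(x <- D2) K x.
Proof.
move=> D12 K0; rewrite [leRHS](big_fsetID _ (mem D1)) /=.
rewrite (_ : [fset x | x in D2 & x \in D1]%fset = D1) ?lerDl ?sumr_ge0//.
apply/fsetP => x; rewrite !inE; case: (boolP (x \in D1)) => xD; rewrite ?andbF//.
by rewrite (fsubsetP D12).
Qed.

End BoundedSums.

Section OpenTriangle.
Variables (R : realType) (d : nat) (A : R).
Hypothesis A0 : 0 <= A.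
Hypothesis d6 : (6 < d)%N.
Local Notation V := 'rV[int]_d.
Implicit Types (x y z u v a b c : V).

Let g x : R := A * norm_pow R x.
(** A single square root keeps all later exponents integral: [g] is a square and its power 3/2 a
    cube. *)
Let h x : R := Num.sqrt (g x).
(* F = g^(3/2) is summable exactly when 3/2 (d - 2) > d, that is d > 6. *)
Let F x : R := h x ^+ 3.

Let g_ge0 x : 0 <= g x.
Proof. by rewrite mulr_ge0// norm_pow_ge0. Qed.

Let h_ge0 x : 0 <= h x.
Proof. exact: sqrtr_ge0. Qed.

Let F_ge0 x : 0 <= F x.
Proof. by rewrite exprn_ge0. Qed.

Let gE x : g x = h x ^+ 2.
Proof. by rewrite sqr_sqrtr. Qed.

Let s2 : R := Num.sqrt 2.

Let s2_ge1 : 1 <= s2.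
Proof. by rewrite -[leLHS]sqrtr1 ler_wsqrtr// ler1n. Qed.

Let s2_gt0 : 0 < s2.
Proof. exact: lt_le_trans s2_ge1. Qed.

Let sA := Num.sqrt A.

Let F_shell j x : (2 ^ j < supnorm x)%N ->
  F x <= sA ^+ 3 * (s2 ^+ (3 * (j * (d - 2))))^-1.
Proof.
move=> jx; rewrite mulnC exprM -exprVn -exprMn /F lerXn2r ?nnegrE//.
  by rewrite mulr_ge0 ?sqrtr_ge0// invr_ge0 exprn_ge0// ltW.
have -> : sA * (s2 ^+ (j * (d - 2)))^-1 =
    Num.sqrt ((sA * (s2 ^+ (j * (d - 2)))^-1) ^+ 2).
  by rewrite sqrtr_sqr ger0_norm// mulr_ge0 ?sqrtr_ge0// invr_ge0 exprn_ge0// ltW//.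
rewrite ler_wsqrtr// exprMn sqr_sqrtr// /g ler_wpM2l//.
apply: (le_trans (norm_pow_ub R (n := 2 ^ j) _ _ _)).
- by apply: leq_trans d6.
- by rewrite expn_gt0.
- exact: ltnW.
rewrite exprVn lef_pV2 ?posrE ?exprn_gt0 ?ltr0n ?expn_gt0//.
by rewrite natrX -!exprM mulnC exprM sqr_sqrtr.
Qed.

(** Dyadic shells contribute at most a geometric series of ratio 2^(-1/2). The constant 8^d covers
    the cardinality of a shell, whose box has side 4 2^j + 1. *)
Let F_box : exists C, forall j, \sum_(x <- box d (2 ^ j)) F x <= C.
Proof.
pose C0 := \sum_(x <- box d (2 ^ 0)) F x.
pose c := sA ^+ 3 * 8 ^+ d; pose rho := s2^-1.
have c0 : 0 <= c by rewrite mulr_ge0 ?exprn_ge0// sqrtr_ge0.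
have rho0 : 0 <= rho by rewrite invr_ge0 ltW.
have rho1 : rho < 1.
  by rewrite invf_lt1// -[ltLHS]sqrtr1 ltr_sqrt// ltr1n.
have step j : \sum_(x <- box d (2 ^ j.+1)) F x <=
    \sum_(x <- box d (2 ^ j)) F x + c * rho ^+ j.
  rewrite (big_fsetID _ (mem (box d (2 ^ j)))) /=.
  rewrite (_ : [fset x | x in _ & x \in box d (2 ^ j)]%fset = box d (2 ^ j)); last first.
    apply/fsetP => x; rewrite !inE !in_box; case: (leqP (supnorm x) (2 ^ j)) => jx.
      by rewrite andbT (leq_trans jx)// leq_exp2l.
    by rewrite andbF.
  rewrite lerD2l; set D := [fset x | x in _ & _]%fset.
  apply: (@le_trans _ _ (\sum_(x <- D) sA ^+ 3 * (s2 ^+ (3 * (j * (d - 2))))^-1)).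
    rewrite big_seq [leRHS]big_seq; apply: ler_sum => x; rewrite !inE !in_box -ltnNge.
    by move=> /andP[_]; exact: F_shell.
  rewrite big_const_seq count_predT iter_addr_0 -mulr_natr -mulrA -[leRHS]mulrA.
  rewrite ler_wpM2l ?exprn_ge0 ?sqrtr_ge0//.
  have Dc : (size D <= (8 * 2 ^ j) ^ d)%N.
    apply: (@leq_trans #|` box d (2 ^ j.+1)|).
      by apply: fsubset_leq_card; apply/fsubsetP => x; rewrite !inE => /andP[].
    rewrite card_box leq_exp2r; last exact: leq_trans d6.
    rewrite expnS; have := expn_gt0 2 j; lia.
  apply: (@le_trans _ _ ((s2 ^+ (3 * (j * (d - 2))))^-1 * ((8 * 2 ^ j) ^ d)%:R)).
    by rewrite ler_wpM2l ?invr_ge0 ?exprn_ge0 ?(ltW s2_gt0)// ler_nat.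
  rewrite expnMn natrM natrX mulrCA ler_wpM2l ?exprn_ge0//.
  rewrite /rho exprVn ler_pdivrMl ?exprn_gt0// ler_pdivlMr ?exprn_gt0//.
  have -> : ((2 ^ j) ^ d)%:R = s2 ^+ (2 * (j * d)) :> R.
    by rewrite exprM sqr_sqrtr// -expnM natrX.
  (* In powers of the square root of 2, and per unit of j, the claim is 2 d + 1 <= 3 (d - 2), that
     is d >= 7. *)
  rewrite -exprD ler_weXn2l//; nia.
exists (C0 + c / (1 - rho)) => j.
have rho1' : 0 < 1 - rho by rewrite subr_gt0.
suff : \sum_(x <- box d (2 ^ j)) F x <= C0 + c * ((1 - rho ^+ j) / (1 - rho)).
  move=> /le_trans; apply; rewrite lerD2l ler_wpM2l// ler_pdivrMr// mulVf ?gt_eqF//.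
  by rewrite gerBl exprn_ge0.
elim: j => [|j ih]; first by rewrite expr0 subrr mul0r mulr0 addr0.
apply: (le_trans (step j)); rewrite -lerBrDr; apply: (le_trans ih).
rewrite -addrA lerD2l -mulrBr ler_wpM2l// lerBrDr -[leLHS]addrC.
rewrite le_eqVlt; apply/orP; left; apply/eqP; rewrite exprS; field.
by rewrite gt_eqF.
Qed.

Let F_sum : exists M, sums_le F M.
Proof.
have [M hM] := F_box; exists M => D.
pose j := \max_(x <- D) supnorm x.
apply: le_trans (hM j); apply: ler_sum_fsubset => //; apply/fsubsetP => x xD.
rewrite in_box; apply: (@leq_trans j); last exact/ltnW/ltn_expl.
exact: leq_bigmax_seq.
Qed.

Let sum_prod (K1 K2 : V -> R) M1 M2 (D : {fset V}) (f1 : V -> V) (f2 : V -> V -> V) :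
  (forall x, 0 <= K1 x) -> sums_le K1 M1 -> sums_le K2 M2 -> injective f1 ->
  (forall x, injective (f2 x)) ->
  \sum_(x <- D) \sum_(z <- D) K1 (f1 x) * K2 (f2 x z) <= M1 * M2.
Proof.
move=> K0 h1 h2 i1 i2.
apply: (@le_trans _ _ (\sum_(x <- D) K1 (f1 x) * M2)).
  apply: ler_sum => x _; rewrite -mulr_sumr ler_wpM2l//.
  exact: (sums_le_inj (i2 x) h2).
rewrite -mulr_suml ler_wpM2r//; first exact: sums_le_ge0 h2.
exact: (sums_le_inj i1 h1).
Qed.

Let AMGM3 (X Y Z : R) : 0 <= X -> 0 <= Y -> 0 <= Z ->
  X * Y * Z <= X ^+ 3 + Y ^+ 3 + Z ^+ 3.
Proof.
move=> X0 Y0 Z0.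
have : 0 <= (X + Y + Z) * ((X - Y) ^+ 2 + (Y - Z) ^+ 2 + (X - Z) ^+ 2).
  by rewrite mulr_ge0 ?addr_ge0 ?sqr_ge0.
have : 0 <= X ^+ 3 + Y ^+ 3 + Z ^+ 3 by rewrite !addr_ge0 ?exprn_ge0.
nra.
Qed.

(* Weighted by AM-GM, g a g b g c is a product of three factors (h h) whose
   cubes are F F; a large [al] makes the product F b F c cheap, which helps when
   [a] lies in the tail of F. *)
Let term_le (al : R) a b c : 0 < al ->
  g a * g b * g c <= al ^+ 3 * (F a * F b) + al ^+ 3 * (F a * F c) +
     (al ^+ 6)^-1 * (F b * F c).
Proof.
move=> al0.
have al2 : 0 < al ^- 2 by rewrite invr_gt0 exprn_gt0.
have := @AMGM3 (al * (h a * h b)) (al * (h a * h c)) (al ^- 2 * (h b * h c)).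
rewrite !mulr_ge0 ?(ltW al0) ?(ltW al2)// => /(_ isT isT isT).
rewrite !gE /F !exprMn exprVn -!exprM; apply: le_trans.
rewrite le_eqVlt; apply/orP; left; apply/eqP; field.
by rewrite gt_eqF.
Qed.

(** Up to sign the three arguments add up to [v]. As [v] is longer than three times the radius of
    [S], at least one of them lies off [S], and every term carries a tail factor. *)
Lemma open_triangle (e : R) : 0 < e -> exists v, forall (D : {fset V}) u,
  \sum_(x <- D) \sum_(z <- D) g (x - u) * g (z - u) * g (x + v - z) <= e.
Proof.
move=> e0; have [M hM] := F_sum.
have M0 := sums_le_ge0 hM.
(* The weight [al] brings the products without a tail factor below e/2 in total; [ep], chosen after
   it, does the same for those multiplied by [al ^+ 3]. *)
pose al : R := 1 + 6 * M ^+ 2 / e.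
have al1 : 1 <= al by rewrite lerDl !mulr_ge0 ?invr_ge0 ?exprn_ge0 ?(ltW e0).
have al0 : 0 < al by exact: lt_le_trans al1.
have al3 : 0 < al ^+ 3 by rewrite exprn_gt0.
pose ep : R := e / (12 * al ^+ 3 * (M + 1)).
have M1 : 0 < M + 1 by rewrite ltr_wpDl.
have ep0 : 0 < ep by rewrite divr_gt0// !mulr_gt0.
have [S hS] := sums_le_tail hM ep0.
pose F' x := if x \in S then 0 else F x.
have F'0 x : 0 <= F' x by rewrite /F'; case: ifP.
pose N := \max_(x <- S) supnorm x.
have d0 : (0 < d)%N by exact: leq_trans d6.
pose v : V := \row_i (3 * N + 1)%N%:Z.
have hv : (3 * N < supnorm v)%N.
  rewrite ltnNge supnorm_le; apply/negP => /forallP /(_ (Ordinal d0)).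
  by rewrite mxE absz_nat addn1 ltnn.
exists v => D u.
have SN x : x \in S -> (supnorm x <= N)%N by move=> xS; exact: leq_bigmax_seq.
have one_out x z : [|| x - u \notin S, z - u \notin S | x + v - z \notin S].
  apply: contraLR hv; rewrite !negb_or !negbK -leqNgt => /and3P[/SN h1 /SN h2 /SN h3].
  have -> : v = (x + v - z) + (z - u) + - (x - u).
    by apply/rowP => i; rewrite !mxE; ring.
  apply: (leq_trans (supnormD _ _)); rewrite supnormN.
  have := leq_add (leq_trans (supnormD (x + v - z) (z - u)) (leq_add h3 h2)) h1.
  by have -> : (3 * N = N + N + N)%N by rewrite !mulSn mul0n addn0 addnA.
pose be := (al ^+ 6)^-1.
have be0 : 0 < be by rewrite invr_gt0 exprn_gt0.
(* Which of the three arguments is in the tail depends on [x] and [z], so the bounds of the three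
   cases are added up. *)
have pt x z : g (x - u) * g (z - u) * g (x + v - z) <=
   (al ^+ 3 * (F' (x - u) * F (z - u)) + al ^+ 3 * (F' (x - u) * F (x + v - z)) +
    be * (F (z - u) * F (x + v - z))) +
   (al ^+ 3 * (F' (z - u) * F (x - u)) + al ^+ 3 * (F' (z - u) * F (x + v - z)) +
    be * (F (x - u) * F (x + v - z))) +
   (al ^+ 3 * (F' (x + v - z) * F (x - u)) + al ^+ 3 * (F' (x + v - z) * F (z - u)) +
    be * (F (x - u) * F (z - u))).
  set a := x - u; set b := z - u; set c := x + v - z.
  have ge0 (r1 r2 r3 r4 r5 r6 : R) : 0 <= r1 -> 0 <= r2 -> 0 <= r3 -> 0 <= r4 ->
      0 <= r5 -> 0 <= r6 ->
      0 <= al ^+ 3 * (r1 * r2) + al ^+ 3 * (r3 * r4) + be * (r5 * r6).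
    by move=> *; rewrite !addr_ge0// !mulr_ge0// ltW.
  have := one_out x z; case/or3P => /negbTE hx.
  - have -> : F' a = F a by rewrite /F' hx.
    rewrite -[leLHS]addr0 lerD ?ge0// -[leLHS]addr0 lerD ?ge0//; exact: term_le.
  - have -> : F' b = F b by rewrite /F' hx.
    rewrite -[leLHS]addr0 lerD ?ge0// -[leLHS]add0r lerD ?ge0//.
    by rewrite [g a * g b]mulrC; exact: term_le.
  - have -> : F' c = F c by rewrite /F' hx.
    rewrite -[leLHS]add0r; apply: lerD; first by apply: addr_ge0; apply: ge0.
    by rewrite [leLHS]mulrC [leLHS]mulrA; exact: term_le.
pose W := al ^+ 3 * (ep * M) + al ^+ 3 * (ep * M) + be * (M * M).
apply: (@le_trans _ _ (W + W + W)).
  apply: (le_trans (ler_sum _ (fun x _ => ler_sum _ (fun z _ => pt x z)))).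
  have iu : injective (fun x => x - u) by exact: addIr.
  have ixz x : injective (fun z => x + v - z) by move=> z z' /addrI /oppr_inj.
  have izx z : injective (fun x => x + v - z) by move=> x x' /addIr /addIr.
  have s_ab (K1 K2 : V -> R) (M1' M2' : R) : (forall x, 0 <= K1 x) -> sums_le K1 M1' -> sums_le K2 M2' ->
      \sum_(x <- D) \sum_(z <- D) K1 (x - u) * K2 (z - u) <= M1' * M2'.
    by move=> k0 h1 h2; exact: (sum_prod D k0 h1 h2 iu (fun=> iu)).
  have s_ac (K1 K2 : V -> R) (M1' M2' : R) : (forall x, 0 <= K1 x) -> sums_le K1 M1' -> sums_le K2 M2' ->
      \sum_(x <- D) \sum_(z <- D) K1 (x - u) * K2 (x + v - z) <= M1' * M2'.
    by move=> k0 h1 h2; exact: (sum_prod D k0 h1 h2 iu ixz).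
  have s_bc (K1 K2 : V -> R) (M1' M2' : R) : (forall x, 0 <= K1 x) -> sums_le K1 M1' -> sums_le K2 M2' ->
      \sum_(x <- D) \sum_(z <- D) K1 (z - u) * K2 (x + v - z) <= M1' * M2'.
    move=> k0 h1 h2; rewrite exchange_big /=.
    exact: (sum_prod D k0 h1 h2 iu izx).
  pose S2 (f : V -> V -> R) := \sum_(x <- D) \sum_(z <- D) f x z.
  have S2D f1 f2 : S2 (fun x z => f1 x z + f2 x z) = S2 f1 + S2 f2.
    by rewrite /S2 -big_split; apply: eq_bigr => x _; rewrite big_split.
  have S2Z (k : R) f1 : S2 (fun x z => k * f1 x z) = k * S2 f1.
    by rewrite /S2 mulr_sumr; apply: eq_bigr => x _; rewrite mulr_sumr.
  have al3' := ltW al3; have be0' := ltW be0.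
  have group f1 f2 f3 : S2 f1 <= ep * M -> S2 f2 <= ep * M -> S2 f3 <= M * M ->
      S2 (fun x z => al ^+ 3 * f1 x z + al ^+ 3 * f2 x z + be * f3 x z) <= W.
    move=> i1 i2 i3; rewrite S2D (S2D (fun x z => al ^+ 3 * f1 x z)) !S2Z.
    by rewrite /W !lerD// ler_wpM2l.
  have swap (f1 f2 : V -> V -> R) : \sum_(x <- D) \sum_(z <- D) f1 x z * f2 x z =
     \sum_(x <- D) \sum_(z <- D) f2 x z * f1 x z.
    by apply: eq_bigr => x _; apply: eq_bigr => z _; rewrite mulrC.
  have t1 : S2 (fun x z => F' (x - u) * F (z - u)) <= ep * M.
    by exact: s_ab.
  have t2 : S2 (fun x z => F' (x - u) * F (x + v - z)) <= ep * M.
    by exact: s_ac.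
  have t3 : S2 (fun x z => F (z - u) * F (x + v - z)) <= M * M.
    by exact: s_bc.
  have t4 : S2 (fun x z => F' (z - u) * F (x - u)) <= ep * M.
    by rewrite /S2 exchange_big; exact: s_ab.
  have t5 : S2 (fun x z => F' (z - u) * F (x + v - z)) <= ep * M.
    by exact: s_bc.
  have t6 : S2 (fun x z => F (x - u) * F (x + v - z)) <= M * M.
    by exact: s_ac.
  have t7 : S2 (fun x z => F' (x + v - z) * F (x - u)) <= ep * M.
    by rewrite /S2 swap mulrC; exact: s_ac.
  have t8 : S2 (fun x z => F' (x + v - z) * F (z - u)) <= ep * M.
    by rewrite /S2 swap mulrC; exact: s_bc.
  have t9 : S2 (fun x z => F (x - u) * F (z - u)) <= M * M.
    by exact: s_ab.
  rewrite -[leLHS]/(S2 _).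
  rewrite (S2D (fun x z => _ + _)) (S2D (fun x z => _ + _ + _)).
  apply: lerD; last exact: (group _ _ _ t7 t8 t9).
  by apply: lerD; [exact: (group _ _ _ t1 t2 t3)|exact: (group _ _ _ t4 t5 t6)].
have h1 : 6 * (al ^+ 3 * (ep * M)) <= e / 2.
  have -> : 6 * (al ^+ 3 * (ep * M)) = e / 2 * (M / (M + 1)).
    by rewrite /ep; field; rewrite !gt_eqF.
  by rewrite ler_piMr ?divr_ge0 ?(ltW e0)// ler_pdivrMr// mul1r lerDl.
have h2 : 3 * (be * (M * M)) <= e / 2.
  have : be <= al^-1.
    by rewrite lef_pV2 ?posrE ?exprn_gt0// -[leLHS]expr1 ler_weXn2l.
  have : 6 * (M * M) <= al * e.
    have -> : al * e = e + 6 * (M * M) by rewrite /al; field; rewrite gt_eqF.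
    by rewrite lerDr ltW.
  move=> h3 h4; apply: (@le_trans _ _ (3 * (al^-1 * (M * M)))).
    by rewrite ler_wpM2l// ler_wpM2r// mulr_ge0.
  have -> : 3 * (al^-1 * (M * M)) = al^-1 * (6 * (M * M)) / 2 by field; rewrite gt_eqF.
  by rewrite ler_wpM2r// ler_pdivrMl.
move: h1 h2; rewrite /W; move: (al ^+ 3 * _) (be * _) => r1 r2; lra.
Qed.

End OpenTriangle.
(** * Volume and survival *)

Section LatticePercolation.
Variables (R : realType) (d : nat) (E : pred {fset 'rV[int]_d}).
Local Notation V := 'rV[int]_d.
Hypothesis hE : lattice R E.
Implicit Types (x y z : V) (N n m k r : nat) (w : config E).

Lemma edge_range : exists l : nat, forall x y, Defs.adjacent E x y ->
  (supnorm (y - x) <= l)%N.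
Proof.
case: hE => _ _ _ [L hL]; exists (Num.truncn `|L|).+1 => x y xy.
rewrite -opprB supnormN supnorm_le; apply/forallP => i.
rewrite -(ler_nat R) (le_trans (coord_le_norm R _ _))// (le_trans (hL _ _ xy))//.
by rewrite (le_trans (ler_norm _))// ltW// Num.Theory.truncnS_gt.
Qed.

Variable l : nat.
Hypothesis hl : forall x y, Defs.adjacent E x y -> (supnorm (y - x) <= l)%N.

Lemma reach_supnorm w n x y : reach w n x y -> (supnorm (y - x) <= n * l)%N.
Proof.
elim: n y => [|n ih] y; first by rewrite reach0 => /eqP->; rewrite subrr supnorm0.
move=> /reachS[/ih h|[z /ih h /open_adjacent_adjacent/hl h']].
  by rewrite (leq_trans h)// leq_mul2r leqnSn orbT.
have -> : y - x = (y - z) + (z - x) by rewrite addrA subrK.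
by rewrite (leq_trans (supnormD _ _))// mulSn leq_add.
Qed.

Lemma reach_box w n x y : reach w n x y -> y \in box d (supnorm x + n * l).
Proof. by move=> /reach_supnorm/supnormB_le; rewrite in_box. Qed.

Definition box_edges N : seq (edge E) :=
  undup (pmap insub [seq [fset x; y] | x <- box d N, y <- box d N]).

Lemma box_edges_uniq N : uniq (box_edges N).
Proof. exact: undup_uniq. Qed.

Lemma mem_box_edges N (e : edge E) x y : val e = [fset x; y] ->
  (supnorm x <= N)%N -> (supnorm y <= N)%N -> e \in box_edges N.
Proof.
move=> ve xN yN; rewrite mem_undup mem_pmap_sub ve.
by apply/allpairsP; exists (x, y); rewrite /= !in_box.
Qed.

(** A path of [n] steps moves by at most n l, so it stays inside the box: restricting to finitely
    many edges loses nothing. *)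
Lemma reach_trace w N n x y : (supnorm x + n * l <= N)%N ->
  reach (cfg (trace (box_edges N) w)) n x y = reach w n x y.
Proof.
move=> xN; apply/idP/idP.
  by apply: reach_sub => e; rewrite /cfg !inE => /andP[].
elim: n y xN => [|n ih] y xN; first by rewrite !reach0.
have xN' : (supnorm x + n * l <= N)%N.
  by rewrite (leq_trans _ xN)// leq_add2l leq_mul2r leqnSn orbT.
move=> xy; have := reach_box xy; rewrite in_box => yN.
case/reachS: xy => [/(ih _ xN')|[z xz /open_adjacentP[e we ve]]].
  exact: reach_le.
rewrite -[n.+1]addn1; apply: reach_trans (ih _ xN' xz) _; apply: reach1.
apply/open_adjacentP; exists e => //; rewrite /cfg !inE we andbT.
have := reach_box xz; rewrite in_box => zN.
apply: (mem_box_edges ve); first exact: leq_trans xN'.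
exact: leq_trans xN.
Qed.

Variables (p : R) (P : probability (config E) R).
Hypothesis p01 : 0 <= p <= 1.
Hypothesis hP : bernoulli_percolation p P.

Lemma measurable_reach n x y : measurable [set w : config E | reach w n x y].
Proof.
have [+ _] := cylinder hP (fun u => reach (cfg u) n x y)
  (box_edges_uniq (supnorm x + n * l)).
by congr measurable; apply/seteqP; split=> w /=; rewrite reach_trace.
Qed.

Definition preach n x y : R := fine (P [set w | reach w n x y]).

Lemma preachE n x y : (preach n x y)%:E = P [set w | reach w n x y].
Proof. by rewrite fineK// fin_num_measure//; exact: measurable_reach. Qed.

Lemma conn_preach N n x y : (supnorm x + n * l <= N)%N ->
  conn p (box_edges N) n x y = preach n x y.
Proof.
move=> xN; have [_ h] := cylinder hP (fun u => reach (cfg u) n x y)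
  (box_edges_uniq N).
apply: EFin_inj; rewrite preachE /conn -h; congr (P _).
by apply/seteqP; split=> w /=; rewrite reach_trace.
Qed.

Lemma conn_le_preach N n x y : conn p (box_edges N) n x y <= preach n x y.
Proof.
have [m h] := cylinder hP (fun u => reach (cfg u) n x y) (box_edges_uniq N).
rewrite -lee_fin preachE /conn -h; apply: le_measure; rewrite ?inE//.
  exact: measurable_reach.
by move=> w /=; apply: reach_sub => e; rewrite /cfg !inE => /andP[].
Qed.

Lemma preach_ge0 n x y : 0 <= preach n x y.
Proof. exact: fine_ge0. Qed.

Lemma preach_support n x y : preach n x y != 0 -> (supnorm (y - x) <= n * l)%N.
Proof.
apply: contraNT => h; rewrite -(@conn_preach (supnorm x + n * l))//.
rewrite /conn /Pr -(Ex_cst p (box_edges (supnorm x + n * l)) 0 fset0).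
apply/eqP/eq_Ex => u; case xy : (reach _ _ _ _) => //.
by rewrite (reach_supnorm xy) in h.
Qed.

Lemma preach_le n m x y : (n <= m)%N -> preach n x y <= preach m x y.
Proof.
move=> nm; rewrite -lee_fin !preachE; apply: le_measure; rewrite ?inE//;
  [exact: measurable_reach..|by move=> w /=; exact: reach_le].
Qed.

Lemma connectsE x y : connects E x y = \bigcup_n [set w | reach w n x y].
Proof.
apply/seteqP; split=> w /=.
  by move=> [s ps]; exists (size s) => //; apply/reachP; exists s.
by move=> [n _ /reachP[s ps _]]; exists s.
Qed.

Lemma measurable_connects x y : measurable (connects E x y).
Proof. by rewrite connectsE; apply: bigcup_measurable => n _; exact: measurable_reach. Qed.

Lemma preach_le_connects n x y : ((preach n x y)%:E <= P (connects E x y))%E.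
Proof.
rewrite preachE; apply: le_measure; rewrite ?inE; [exact: measurable_reach|
  exact: measurable_connects|].
by rewrite connectsE => w /= h; exists n.
Qed.

Lemma preach_cvg x y : (fun n => (preach n x y)%:E) @ \oo --> P (connects E x y).
Proof.
rewrite connectsE (_ : (fun n => _) = P \o (fun n => [set w | reach w n x y])).
  apply: nondecreasing_cvg_mu; [move=> n; exact: measurable_reach| |].
    by apply: bigcup_measurable => n _; exact: measurable_reach.
  by move=> n m nm; apply/subsetPset => w /=; exact: reach_le.
by apply/funext => n /=; rewrite preachE.
Qed.

(** * Translation invariance *)

Let shift_edge_subproof z (e : edge E) : [fset (a + z)%R | a in val e]%fset \in E.
Proof.
case: hE => card2 _ hshift _.
have ce := card2 _ (svalP e).
have /fset0Pn[a ae] : val e != fset0 by rewrite -cardfs_gt0 ce.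
have /cardfs1P[b be] : #|` val e `\ a| == 1%N.
  by rewrite -eqSS -ce (cardfsD1 a (val e)) ae.
have ve : val e = [fset a; b] by rewrite -be fsetD1K.
have := hshift a b z; rewrite /Defs.adjacent -ve (svalP e).
rewrite (_ : [fset (a + z)%R; (b + z)%R] = [fset (c + z)%R | c in val e]%fset)//.
apply/fsetP => c; rewrite !inE; apply/orP/imfsetP => /=.
  by case=> /eqP->; [exists a|exists b] => //; rewrite ve !inE eqxx ?orbT.
move=> [c']; rewrite ve !inE => /orP[]/eqP-> ->; by [left|right].
Qed.

Let shift_edge z (e : edge E) : edge E :=
  exist (fun e => e \in E) _ (shift_edge_subproof z e).

Let shift_edge_inj z : injective (shift_edge z).
Proof.
move=> e e' /(congr1 val) /= h; apply: val_inj.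
suff sub (A B : {fset V}) : [fset (a + z)%R | a in A]%fset = [fset (a + z)%R | a in B]%fset ->
    A `<=` B.
  by apply/eqP; rewrite eqEfsubset !sub.
move=> AB; apply/fsubsetP => a aA.
have /imfsetP[b /= bB /addIr ->//] : a + z \in [fset (a + z)%R | a in B]%fset.
by rewrite -AB; apply/imfsetP; exists a.
Qed.

Let shift z (w : config E) : config E := fun e => w (shift_edge z e).

Let measurable_shift z : measurable_fun setT (shift z).
Proof.
apply: (@measurability _ _ _ _ setT (shift z) (range (@edge_open _ E))) => //.
move=> _ [_ [e _ <-] <-]; rewrite setTI.
by apply: sub_sigma_algebra; exists (shift_edge z e).
Qed.

Let reach_shift z w n x y : reach (shift z w) n x y -> reach w n (x + z) (y + z).
Proof.
elim: n y => [|n ih] y; first by rewrite !reach0 => /eqP->.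
move=> /reachS[/ih|[v /ih xv /open_adjacentP[e we ve]]]; first exact: reach_le.
rewrite -[n.+1]addn1; apply: reach_trans xv _; apply: reach1; apply/open_adjacentP.
exists (shift_edge z e) => //; rewrite /= ve.
apply/fsetP => c; rewrite !inE; apply/imfsetP/orP => /=.
  by move=> [c']; rewrite !inE => /orP[]/eqP-> ->; [left|right].
by case=> /eqP->; [exists v|exists y] => //; rewrite !inE eqxx ?orbT.
Qed.

(** The image of the law under a translation gives every finite set of edges the same probability of
    being open, so uniqueness identifies the two laws. *)
Let preach_shift_le z n x y : preach n x y <= preach n (x + z) (y + z).
Proof.
pose th := @mfun_Sub _ _ (config E) (config E) (shift z) (mem_set (measurable_shift z)).
have Qb : bernoulli_percolation p (distribution P th).
  move=> F; rewrite /distribution /pushforward /=.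
  have := hP [fset shift_edge z e | e in F]%fset.
  rewrite card_imfset//= => <-; congr (P _); apply/seteqP; split=> w /= h e.
    by move=> /imfsetP[e' e'F ->]; exact: h.
  by move=> eF; apply: h; rewrite mem_imfset.
rewrite -lee_fin !preachE.
rewrite (bernoulli_percolation_unique hP Qb (measurable_reach n x y)).
rewrite [leLHS](_ : _ = P (shift z @^-1` [set w | reach w n x y]))//.
apply: le_measure; rewrite ?inE.
- by have := measurable_shift z measurableT (measurable_reach n x y); rewrite setTI.
- exact: measurable_reach.
- by move=> w /=; exact: reach_shift.
Qed.

Lemma preach_shift z n x y : preach n (x + z) (y + z) = preach n x y.
Proof.
apply/eqP; rewrite eq_le preach_shift_le andbT.
by have := preach_shift_le (- z) n (x + z) (y + z); rewrite !addrK.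
Qed.

(** * The mean volume G(r), as a finite sum over a box *)

Definition volume r : R := \sum_(x <- box d (r * l)) preach r 0 x.

Lemma sum_preach_le (D : {fset V}) r x : \sum_(y <- D) preach r x y <= volume r.
Proof.
pose D' := [fset (y - x)%R | y in D]%fset.
have -> : \sum_(y <- D) preach r x y = \sum_(y <- D') preach r 0 y.
  rewrite big_imfset/=; last by move=> a b _ _; exact: addIr.
  by apply: eq_bigr => y _; rewrite -[in RHS](preach_shift x) add0r subrK.
have -> : volume r = \sum_(y <- (box d (r * l) `|` D')) preach r 0 y.
  apply: big_fset_incl => [|y _ yb]; first exact: fsubsetUl.
  apply/eqP; apply: contraNT yb => /preach_support; by rewrite subr0 in_box.
by apply: ler_sum_fsubset; [exact: fsubsetUr|move=> y; exact: preach_ge0].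
Qed.

Lemma sum_preach_eq (D : {fset V}) r x :
  (forall y, (supnorm (y - x) <= r * l)%N -> y \in D) ->
  \sum_(y <- D) preach r x y = volume r.
Proof.
move=> hD; apply/eqP; rewrite eq_le sum_preach_le /=.
pose B := [fset (y + x)%R | y in box d (r * l)]%fset.
have -> : volume r = \sum_(y <- B) preach r x y.
  rewrite big_imfset/=; last by move=> a b _ _; exact: addIr.
  by apply: eq_bigr => y _; rewrite -[LHS](preach_shift x) add0r.
rewrite le_eqVlt; apply/orP; left; apply/eqP; apply: big_fset_incl => [|y _ yB].
  apply/fsubsetP => _ /imfsetP[y + ->]; rewrite in_box => yr.
  by apply: hD; rewrite addrK.
apply/eqP; apply: contraNT yB => /preach_support h.
by apply/imfsetP; exists (y - x); rewrite ?in_box ?subrK.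
Qed.

Lemma volume_ge0 r : 0 <= volume r.
Proof. by apply: sumr_ge0 => x _; exact: preach_ge0. Qed.

Lemma volume_le r k : (r <= k)%N -> volume r <= volume k.
Proof.
move=> rk; apply: le_trans (sum_preach_le (box d (r * l)) k 0).
by apply: ler_sum => x _; exact: preach_le.
Qed.

Lemma preach_le1 n x y : preach n x y <= 1.
Proof. by rewrite -lee_fin preachE probability_le1//; exact: measurable_reach. Qed.

Lemma volume_le_card r : volume r <= ((2 * (r * l)).+1 ^ d)%:R.
Proof.
rewrite -(card_box d) /volume (le_trans (ler_sum _ (fun x _ => preach_le1 r 0 x)))//.
by rewrite big_const_seq count_predT iter_addr_0.
Qed.

(** Sum the sphere decomposition over [y]: by translation invariance each vertex of the sphere
    contributes at most [volume k]. *)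
Lemma volume_decomp r k : volume (r.+1 + k) <= volume r + (volume r.+1 - volume r) * volume k.
Proof.
pose D := box d ((r.+1 + k) * l); pose N := ((r.+1 + k) * l + (r.+1 + k) * l)%N.
have rk : (r.+1 <= r.+1 + k)%N by exact: leq_addr.
have inD j : (j <= r.+1 + k)%N -> forall y : V, (supnorm (y - 0) <= j * l)%N -> y \in D.
  move=> jr y; rewrite subr0 in_box => /leq_trans; apply.
  by rewrite leq_mul2r jr orbT.
have in_N (z : V) j : z \in D -> (j <= r.+1 + k)%N -> (supnorm z + j * l <= N)%N.
  by rewrite in_box => zD jr; rewrite leq_add// leq_mul2r jr orbT.
have D0 : 0 \in D by rewrite in_box supnorm0.
have c0 j z : (j <= r.+1 + k)%N -> conn p (box_edges N) j 0 z = preach j 0 z.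
  by move=> jr; apply: conn_preach; exact: in_N.
have r1 : (r <= r.+1 + k)%N by exact: leq_trans (leqnSn r) rk.
apply: (@le_trans _ _ (\sum_(y <- D) (preach r 0 y +
    \sum_(z <- D) (preach r.+1 0 z - preach r 0 z) * preach k z y))).
  apply: ler_sum => y _; rewrite -!c0//.
  apply: (le_trans (@conn_sphere_decomp R V E p p01 (box_edges N) D r k 0 y _)).
    move=> u z /reach_box; rewrite supnorm0 !in_box => /leq_trans; apply.
    by rewrite add0n leq_mul2r rk orbT.
  rewrite lerD2l; apply: ler_sum => z _; rewrite -!c0// ler_wpM2l ?conn_le_preach//.
  by rewrite subr_ge0; apply: conn_le.
rewrite big_split /= (sum_preach_eq (inD r r1)) lerD2l exchange_big /=.
rewrite -(sum_preach_eq (inD r r1)) -(sum_preach_eq (inD r.+1 rk)) -sumrB mulr_suml.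
apply: ler_sum => z _; rewrite -mulr_sumr ler_wpM2l ?sum_preach_le//.
by rewrite subr_ge0 preach_le.
Qed.

(** * Lower bound on the mean volume from the two-point estimate *)

Variables (a A : R).
Hypothesis a0 : 0 < a.
Hypothesis aA : a <= A.
Hypothesis two_point : forall x y, ((a * norm_pow R (x - y))%:E <= P (connects E x y)
      <= (A * norm_pow R (x - y))%:E)%E.

Lemma preach_ub n x y : preach n x y <= A * norm_pow R (x - y).
Proof.
rewrite -lee_fin; have /andP[_] := two_point x y; apply: le_trans.
exact: preach_le_connects.
Qed.

(** A bound on all volumes would pass to the sum of P(0 <-> x) over any finite set. The box of
    radius n has at least n^d points, each contributing at least a (d n)^(2 - d), which is of order
    n^2; keeping order n suffices. *)
Lemma volume_unbounded M : (2 <= d)%N -> exists k, M < volume k.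
Proof.
move=> d2; apply: contrapT => /forallNP H.
have hM k : volume k <= M by rewrite leNgt; apply/negP; exact: H.
have hM' (D : {fset V}) : \sum_(x <- D) a * norm_pow R (0 - x) <= M.
  have cv x : (fun n => preach n 0 x) @ \oo --> fine (P (connects E 0 x)).
    have /fine_cvg : (fun n => (preach n 0 x)%:E) @ \oo --> (fine (P (connects E 0 x)))%:E.
      rewrite fineK; first exact: preach_cvg.
      by rewrite fin_num_measure//; exact: measurable_connects.
    exact.
  have cvD : (fun n => \sum_(x <- D) preach n 0 x) @ \oo -->
      \sum_(x <- D) fine (P (connects E 0 x)).
    elim: (enum_fset D) => [|x s ih].
      by under eq_fun do rewrite big_nil; rewrite big_nil; exact: cvg_cst.
    by under eq_fun do rewrite big_cons; rewrite big_cons; exact: cvgD.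
  apply: (@le_trans _ _ (\sum_(x <- D) fine (P (connects E 0 x)))).
    apply: ler_sum => x _; rewrite -lee_fin fineK; first by case/andP: (two_point 0 x).
    by rewrite fin_num_measure//; exact: measurable_connects.
  rewrite -(cvg_lim _ cvD)//; apply: limr_le; first by apply/cvg_ex; eexists; exact: cvD.
  by near=> n; exact: le_trans (sum_preach_le D n 0) (hM n).
have d0 : (0 < d)%N by exact: leq_trans d2.
pose c : R := a / d%:R ^+ (d - 2).
have c0 : 0 < c by rewrite divr_gt0// exprn_gt0// ltr0n.
have key n : (0 < n)%N -> c * n%:R <= M.
  move=> n0; apply: le_trans (hM' (box d n)).
  apply: (@le_trans _ _ (\sum_(x <- box d n) a * ((d * n)%:R ^+ (d - 2))^-1)).
    rewrite big_const_seq count_predT iter_addr_0.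
    rewrite (_ : size _ = ((2 * n).+1 ^ d)%N); last exact: card_box.
    rewrite -[leRHS]mulr_natr /c -!mulrA ler_wpM2l ?(ltW a0)// natrM exprMn invfM -!mulrA.
    rewrite ler_wpM2l ?invr_ge0 ?exprn_ge0// ler_pdivlMl ?exprn_gt0 ?ltr0n//.
    rewrite -natrX -natrM ler_nat -expnSr.
    apply: (@leq_trans (n ^ d)).
      by rewrite leq_pexp2l//; lia.
    by rewrite leq_exp2r//; lia.
  rewrite big_seq [leRHS]big_seq; apply: ler_sum => x; rewrite in_box => xn.
  by rewrite ler_wpM2l ?(ltW a0)// norm_pow_lb// sub0r supnormN.
have := Num.Theory.truncnS_gt (M / c); set n := Num.truncn _ => h.
have := key n.+1 isT; rewrite leNgt mulrC -ltr_pdivrMr ?h//.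
Unshelve. all: by end_near.
Qed.

(** With an increment [sg] below 1, the decomposition solves to [volume k <= volume r / (1 - sg)]
    for every [k]. *)
Lemma volume_succ r : (2 <= d)%N -> volume r + 1 <= volume r.+1.
Proof.
move=> d2; rewrite -lerBrDl leNgt; apply/negP => lt1.
set sg := volume r.+1 - volume r in lt1.
have sg0 : 0 < 1 - sg by rewrite subr_gt0.
have [k] := volume_unbounded (volume r / (1 - sg)) d2; apply/negP; rewrite -leNgt.
rewrite ler_pdivlMr// mulrBr mulr1 lerBlDr mulrC.
by apply: le_trans (volume_decomp r k); apply: volume_le; exact: leq_addl.
Qed.

Lemma volume_lb r : (2 <= d)%N -> r%:R <= volume r.
Proof.
move=> d2; elim: r => [|r ih]; first exact: volume_ge0.
by apply: le_trans (volume_succ r d2); rewrite -natr1 lerD2r.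
Qed.

(** At p = 0 the ball is reduced to the origin, while [volume 2] is at least 2. Positivity allows
    division by the cost [p ^+ m] of opening a path. *)
Lemma p_gt0 : (2 <= d)%N -> 0 < p.
Proof.
move=> d2; rewrite lt_neqAle; case/andP: p01 => -> _; rewrite andbT.
apply/negP => /eqP p0; have := volume_lb 2 d2; apply/negP; rewrite -ltNge.
apply: (@le_lt_trans _ _ 1); last by rewrite ltr1n.
pose N := (2 * l)%N.
have preachE0 y : preach 2 0 y = (y == 0)%:R.
  rewrite -(@conn_preach N)//; last by rewrite supnorm0.
  rewrite /conn /Pr -p0.
  have -> s (f : {fset edge E} -> R) u : Ex 0 s f u = f u.
    by elim: s u => //= e s ih u; rewrite !ih mul0r add0r subr0 mul1r.
  congr (_%:R); congr nat_of_bool.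
  apply/idP/eqP => [|->]; last exact: reach_refl.
  case/reachP => -[|b s]; first by case=> _ /= ->.
  by case=> /= /andP[/open_adjacentP[e]]; rewrite /cfg inE.
rewrite /volume (eq_bigr _ (fun y _ => preachE0 y)) (bigD1_seq 0) ?fset_uniq//=; last first.
  by rewrite in_box supnorm0.
by rewrite eqxx big1 ?addr0// => y /negbTE->.
Qed.

(** * Linear upper bound on the mean volume *)

Lemma shifted_path v : exists t0 : seq V, forall x,
  path (Defs.adjacent E) x [seq b + x | b <- t0] /\
  last x [seq b + x | b <- t0] = x + v.
Proof.
(* One path from the origin is translated to every [x], which makes its length and the overlaps
   uniform. *)
case: hE => _ conn _ _; have [t0 [pt lt]] := conn 0 v; exists t0 => x.
suff main b t : path (Defs.adjacent E) b t ->
    path (Defs.adjacent E) (b + x) [seq c + x | c <- t] /\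
    last (b + x) [seq c + x | c <- t] = last b t + x.
  by have := main 0 t0 pt; rewrite add0r lt addrC.
elim: t b => //= c t ih b /andP[bc /ih[-> ->]].
by case: hE => _ _ -> _; rewrite bc.
Qed.

(** The vertex [b] is on the translate based at [x] only if [x] is [b] minus one of the
    [(size t0).+1] vertices of the base path. *)
Lemma shifted_count (t0 : seq V) (X : {fset V}) b :
  (count (fun x => b \in x :: [seq (c + x)%R | c <- t0]) X <= (size t0).+1)%N.
Proof.
rewrite -size_filter (_ : (size t0).+1 = size [seq b - c | c <- 0 :: t0]); last first.
  by rewrite size_map.
apply: uniq_leq_size; first by rewrite filter_uniq// fset_uniq.
move=> x; rewrite mem_filter => /andP[bx _].
have /mapP[c ct ->] : b \in [seq c + x | c <- 0 :: t0] by rewrite /= add0r.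
by apply/mapP; exists c; rewrite // addrAC subrr add0r.
Qed.

Let g x : R := A * norm_pow R x.

Let A_ge0 : 0 <= A.
Proof. exact: le_trans (ltW a0) aA. Qed.

Let g_ge0 x : 0 <= g x.
Proof. by rewrite mulr_ge0// norm_pow_ge0. Qed.

Let preach_le_g n x y : preach n x y <= g (y - x).
Proof. by rewrite /g -opprB norm_powN; exact: preach_ub. Qed.

Let preach_le_g' n x y : preach n x y <= g (x - y).
Proof. exact: preach_ub. Qed.

Lemma volume_step : (6 < d)%N -> exists2 K, 0 < K & exists m, forall r n,
  (r + m + r <= n)%N -> volume r ^+ 2 <= K * n.+1%:R * volume n.
Proof.
move=> d6; have d2 : (2 <= d)%N by exact: leq_trans d6.
(* Half of [volume r ^+ 2] may be lost; the factor 2 in the constant below makes up for it. *)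
have [|v hv] := @open_triangle R d A A_ge0 d6 (1 / 2).
  by rewrite divr_gt0.
have [t0 ht0] := shifted_path v.
pose m := size t0; pose M := m.+1.
have pm0 : 0 < p ^+ m by rewrite exprn_gt0// p_gt0.
exists (2 * M%:R / p ^+ m); first by rewrite divr_gt0// mulr_gt0// ltr0n.
exists m => r n rmn.
have rn : (r <= n)%N by apply: leq_trans rmn; rewrite leq_addl.
pose tm := \max_(b <- t0) supnorm b.
pose N := (r * l + supnorm v + r * l + tm)%N.
pose X := box d (r * l); pose Y := box d (r * l + supnorm v + r * l).
pose D := box d (n * l).
pose s := box_edges N.
pose far x y := Pr p s (far_pair D n r 0 x (x + v) y).
have hD u z : reach (cfg u : config E) n 0 z -> z \in D.
  by move=> /reach_box; rewrite supnorm0.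
have hX u z : reach (cfg u : config E) r 0 z -> z \in X.
  by move=> /reach_box; rewrite supnorm0.
have Xv x : x \in X -> (supnorm (x + v) <= r * l + supnorm v)%N.
  by rewrite in_box => xr; apply: leq_trans (supnormD _ _) _; rewrite leq_add2r.
have XN : (supnorm (0 : V) + r * l <= N)%N by rewrite supnorm0 add0n /N -!addnA leq_addr.
have XvN x : x \in X -> (supnorm (x + v) + r * l <= N)%N.
  by move=> /Xv h; rewrite /N -addnA leq_add// leq_addr.
have ub : p ^+ m * \sum_(y <- Y) \sum_(x <- X) far x y <= (n.+1 * M)%:R * volume n.
  rewrite mulr_sumr; apply: (@le_trans _ _ (\sum_(y <- Y) (n.+1 * M)%:R * preach n 0 y)).
    apply: ler_sum => y _.
    apply: (@le_trans _ _ ((n.+1 * M)%:R * conn p s n 0 y)); last first.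
      by rewrite ler_wpM2l// conn_le_preach.
    apply: (@far_pair_ub R V E p p01 s D n m r 0 y X (fun x => x + v)
      (fun x => [seq b + x | b <- t0]) M) => //.
    - by move=> x; rewrite size_map.
    - move=> x; rewrite in_box => xX e /mem_edges_of[b [c [ve hb hc]]].
      have bnd b' : b' \in x :: [seq b + x | b <- t0] -> (supnorm b' <= N)%N.
        rewrite inE => /orP[/eqP->|/mapP[b0 bt ->]].
          by rewrite (leq_trans xX)// /N -!addnA leq_addr.
        have h1 : (supnorm b0 <= tm)%N by exact: leq_bigmax_seq.
        apply: leq_trans (supnormD _ _) _; rewrite addnC leq_add//.
        by rewrite (leq_trans xX)// -addnA leq_addr.
      by apply: (mem_box_edges ve); exact: bnd.
    - by move=> b; exact: shifted_count.
  by rewrite -mulr_sumr ler_wpM2l// sum_preach_le.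
(* The tree-graph bound for joining the origin to [x] and [z] through [u], times the bound for
   joining [x + v] to [z]. For fixed [u], the sum over [x] and [z] is the open triangle. *)
pose B x z := (\sum_(u <- X) preach r 0 u * (g (x - u) * g (z - u))) * g (x + v - z).
have B0 x z : 0 <= B x z.
  apply: mulr_ge0; last exact: g_ge0.
  apply: sumr_ge0 => u _; apply: mulr_ge0; first exact: preach_ge0.
  by apply: mulr_ge0; exact: g_ge0.
have far_lb x y : x \in X ->
    preach r 0 x * preach r (x + v) y - \sum_(z <- D) B x z * preach r z y <= far x y.
  move=> xX.
  apply: le_trans (@far_pair_lb R V E p p01 s D n r 0 x (x + v) y rn hD).
  rewrite !conn_preach ?XvN// lerB// ler_sum// => z _.
  rewrite mulrA; apply: ler_pM => //; rewrite ?mulr_ge0 ?conn_ge0 ?Pr_ge0 ?preach_ge0//.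
  - apply: ler_pM; rewrite ?Pr_ge0 ?conn_ge0//; last first.
      exact: le_trans (conn_le_preach _ _ _ _) (preach_le_g' _ _ _).
    apply: (le_trans (@tree_graph R V E p p01 s X r n 0 x z hX)).
    apply: ler_sum => u _.
    apply: ler_pM; rewrite ?mulr_ge0 ?conn_ge0 ?conn_le_preach//.
    by apply: ler_pM; rewrite ?conn_ge0//; exact: le_trans (conn_le_preach _ _ _ _) (preach_le_g _ _ _).
  - exact: conn_le_preach.
have lb : volume r ^+ 2 - volume r * (volume r * (1 / 2)) <= \sum_(y <- Y) \sum_(x <- X) far x y.
  apply: (@le_trans _ _ (\sum_(y <- Y) \sum_(x <- X)
      (preach r 0 x * preach r (x + v) y - \sum_(z <- D) B x z * preach r z y))); last first.
    apply: ler_sum => y _; rewrite big_seq [leRHS]big_seq.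
    by apply: ler_sum => x; exact: far_lb.
  rewrite exchange_big /=.
  under eq_bigr => x _ do rewrite sumrB.
  rewrite sumrB lerB//.
    rewrite expr2 {1}/volume mulr_suml big_seq [leRHS]big_seq; apply: ler_sum => x xX.
    rewrite -mulr_sumr (sum_preach_eq (D := Y))// => y /supnormB_le hy.
    by rewrite in_box (leq_trans hy)// leq_add2r Xv.
  (* The range of [x] is enlarged from [X] to [D], since [open_triangle] has both variables in the
     same set. *)
  apply: (@le_trans _ _ (\sum_(x <- D) \sum_(z <- D) B x z * volume r)).
    apply: (@le_trans _ _ (\sum_(x <- X) \sum_(z <- D) B x z * volume r)).
      apply: ler_sum => x _; rewrite exchange_big /=; apply: ler_sum => z _.
      by rewrite -mulr_sumr ler_wpM2l// sum_preach_le.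
    apply: ler_sum_fsubset.
      by apply/fsubsetP => x; rewrite !in_box => /leq_trans; apply; rewrite leq_mul2r rn orbT.
    by move=> x; apply: sumr_ge0 => z _; rewrite mulr_ge0// volume_ge0.
  under eq_bigr => x _ do rewrite -mulr_suml.
  rewrite -mulr_suml mulrC ler_wpM2l ?volume_ge0//.
  have -> : \sum_(x <- D) \sum_(z <- D) B x z = \sum_(u <- X) preach r 0 u *
      \sum_(x <- D) \sum_(z <- D) g (x - u) * g (z - u) * g (x + v - z).
    under [RHS]eq_bigr => u _ do rewrite mulr_sumr.
    rewrite [RHS]exchange_big /=; apply: eq_bigr => x _.
    under [RHS]eq_bigr => u _ do rewrite mulr_sumr.
    rewrite [RHS]exchange_big /=; apply: eq_bigr => z _.
    by rewrite /B mulr_suml; apply: eq_bigr => u _; rewrite !mulrA.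
  rewrite /volume mulr_suml; apply: ler_sum => u _.
  by rewrite ler_wpM2l ?preach_ge0//; exact: hv.
have h := le_trans (ler_wpM2l (ltW pm0) lb) ub.
have -> : 2 * M%:R / p ^+ m * n.+1%:R * volume n =
    2 / p ^+ m * ((n.+1 * M)%:R * volume n) by rewrite natrM; ring.
apply: le_trans (ler_wpM2l _ h); last by rewrite divr_ge0// ltW.
by rewrite le_eqVlt; apply/orP; left; apply/eqP; field; rewrite gt_eqF.
Qed.

(** Excess propagates: from G(3r) >= G(r)^2 / (K1 r), a ratio G(r) / r above [B] forces a factor
    3^(d+1) at each tripling, while the box containing the ball grows only by 3^d. *)
Lemma volume_ub : (6 < d)%N -> exists2 C, 0 < C & forall r, (1 <= r)%N -> volume r <= C * r%:R.
Proof.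
move=> d6; have [K K0 [m hm]] := volume_step d6.
(* The factor 4 comes from 3 r + 1 <= 4 r. *)
pose K1 := K * 4; have K1_gt0 : 0 < K1 by rewrite mulr_gt0.
pose B := K1 * 3 ^+ d.+1; have B0 : 0 < B by rewrite mulr_gt0// exprn_gt0.
have triple r : (1 <= r)%N -> (m <= r)%N -> volume r ^+ 2 <= K1 * r%:R * volume (3 * r).
  move=> r1 mr; apply: (le_trans (hm r (3 * r)%N _)).
    have -> : (3 * r = r + r + r)%N by rewrite !mulSn mul0n addn0 addnA.
    by rewrite leq_add2r leq_add2l.
  rewrite ler_wpM2r ?volume_ge0// /K1 -mulrA ler_wpM2l ?(ltW K0)// -natrM ler_nat.
  by rewrite [(4 * r)%N]mulSn -add1n leq_add2r.
have small r : (1 <= r)%N -> (m <= r)%N -> volume r <= B * r%:R.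
  move=> r1 mr; rewrite leNgt; apply/negP => big.
  have r0 : 0 < r%:R :> R by rewrite ltr0n.
  have grow k : B * (3 ^ k * r)%:R < volume (3 ^ k * r) /\
      3 ^+ (d.+1 * k) * volume r <= volume (3 ^ k * r).
    elim: k => [|k [ih1 ih2]]; first by rewrite mul1n muln0 expr0 mul1r.
    set r' := (3 ^ k * r)%N in ih1 ih2 *.
    have rr' : (r <= r')%N by rewrite leq_pmull// expn_gt0.
    have r'0 : 0 < r'%:R :> R by rewrite ltr0n (leq_trans r1).
    have Er : (3 ^ k.+1 * r = 3 * r')%N by rewrite /r' expnS mulnA.
    have Gr' : 0 < volume r' by apply: le_lt_trans ih1; rewrite mulr_ge0 ?(ltW B0).
    have step : 3 ^+ d.+1 * volume r' <= volume (3 * r').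
      have h := triple r' (leq_trans r1 rr') (leq_trans mr rr').
      rewrite -(ler_pM2l (mulr_gt0 K1_gt0 r'0)); apply: le_trans h.
      rewrite expr2 mulrA ler_wpM2r ?(ltW Gr')// (le_trans _ (ltW ih1))//.
      by rewrite (_ : B * _ = K1 * r'%:R * 3 ^+ d.+1)// /B mulrAC.
    rewrite Er; split.
      apply: lt_le_trans step; rewrite natrM mulrCA.
      apply: (@lt_le_trans _ _ (3%:R * volume r')); first by rewrite ltr_pM2l.
      rewrite ler_wpM2r ?(ltW Gr')// -[leLHS]expr1 ler_weXn2l//.
      by rewrite ler1n.
    apply: le_trans step; rewrite mulnS exprD -mulrA ler_wpM2l ?exprn_ge0//.
  have Gr : 0 < volume r by apply: le_lt_trans big; rewrite mulr_ge0 ?(ltW B0)// ltW.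
  (* After k triplings, 3^((d+1)k) volume r is at most 3^(dk) (2 r l + 1)^d, so k <= 3^k <= c for
     every k. *)
  pose c : R := (2 * (r * l)).+1%:R ^+ d / volume r.
  have bnd k : k%:R <= c.
    have [_ hk] := grow k; rewrite /c ler_pdivlMr//.
    have lin : ((2 * (3 ^ k * r * l)).+1 <= 3 ^ k * (2 * (r * l)).+1)%N.
      by rewrite -[(3 ^ k * r * l)%N]mulnA mulnCA mulnS addnC -addn1 leq_add2l expn_gt0.
    have : 3 ^+ (d * k) * (3 ^+ k * volume r) <= 3 ^+ (d * k) * (2 * (r * l)).+1%:R ^+ d.
      rewrite mulrA -exprD addnC -mulSn; apply: (le_trans hk).
      apply: (le_trans (volume_le_card _)); rewrite [(d * k)%N]mulnC exprM -exprMn -!natrX.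
      by rewrite -natrM -natrX ler_nat leq_exp2r// (leq_trans _ d6).
    rewrite ler_pM2l ?exprn_gt0//; apply: le_trans.
    by rewrite ler_wpM2r ?(ltW Gr)// -natrX ler_nat ltnW// ltn_expl.
  have := Num.Theory.truncnS_gt c; set n := Num.truncn c => h.
  by have := bnd n.+1; rewrite leNgt h.
(* The finitely many smaller radii are covered by monotonicity, at the price of adding [volume m']
   to the constant. *)
pose m' := maxn m 1.
have m'1 : (1 <= m')%N by rewrite leq_maxr.
exists (B + volume m'); first by rewrite ltr_pwDl// volume_ge0.
move=> r r1; have r1' : 1 <= r%:R :> R by rewrite ler1n.
case: (leqP m' r) => mr.
  apply: (le_trans (small r r1 _)); first by rewrite (leq_trans _ mr)// leq_maxl.
  by rewrite ler_wpM2r// lerDl volume_ge0.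
apply: (le_trans (volume_le (ltnW mr))).
apply: (@le_trans _ _ (volume m' * r%:R)); first by rewrite ler_peMr// volume_ge0.
by rewrite ler_wpM2r// lerDr ltW.
Qed.

(** * Survival by the second moment method *)

Lemma second_moment N k :
  \sum_(x <- box d (k * l)) \sum_(y <- box d (k * l)) Pr p (box_edges N)
     (fun u => reach (cfg u) k 0 x && reach (cfg u) k 0 y) <= volume k ^+ 3.
Proof.
pose s := box_edges N; set D := box d _.
have hD u z : reach (cfg u : config E) k 0 z -> z \in D.
  by move=> /reach_box; rewrite supnorm0.
apply: (@le_trans _ _ (\sum_(x <- D) \sum_(y <- D) \sum_(v <- D)
    preach k 0 v * (preach k v x * preach k v y))).
  apply: ler_sum => x _; apply: ler_sum => y _.
  apply: (le_trans (@tree_graph R _ E p p01 s D k k 0 x y hD)).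
  apply: ler_sum => v _; apply: ler_pM; rewrite ?mulr_ge0 ?conn_ge0 ?conn_le_preach//.
  by apply: ler_pM; rewrite ?conn_ge0 ?conn_le_preach.
(* The two end vertices are summed before the branch vertex, so that each of the three legs yields a
   factor [volume k]. *)
under eq_bigr => x _ do rewrite exchange_big /=.
rewrite exchange_big /= exprS [X in _ <= X * _]/volume mulr_suml; apply: ler_sum => v _.
under eq_bigr => x _ do rewrite -mulr_sumr -mulr_sumr.
rewrite -mulr_sumr ler_wpM2l ?preach_ge0// -mulr_suml expr2.
by apply: ler_pM; rewrite ?sum_preach_le ?sumr_ge0// => y _; exact: preach_ge0.
Qed.

(** Walking back from [x] to the origin, the last vertex seen before entering the ball of radius [r]
    is one step away from it. *)
Lemma reach_sphere w r k x : reach w k 0 x -> ~~ reach w r x 0 ->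
  exists y, reach w r.+1 0 y && ~~ reach w r 0 y.
Proof.
rewrite (reach_sym _ r); elim: k x => [|k ih] x.
  by rewrite reach0 => /eqP <-; rewrite reach_refl.
move=> /reachS[/ih//|[z zk zx]] xr.
case: (boolP (reach w r 0 z)) => zr; last exact: ih zk zr.
by exists x; rewrite xr andbT -[r.+1]addn1; apply: reach_trans zr (reach1 zx).
Qed.

Let sphere_event r : set (config E) := [set w | open_sphere R w 0 r.+1 !=set0].

Let sphere_cyl N r : ((r.+1) * l <= N)%N ->
  P (sphere_event r) = (Pr p (box_edges N)
    (fun u => has (fun y => reach (cfg u) r.+1 0 y && ~~ reach (cfg u) r 0 y)
       (box d (r.+1 * l))))%:E.
Proof.
move=> rN; have [_ <-] := cylinder hP (fun u => has (fun y =>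
    reach (cfg u) r.+1 0 y && ~~ reach (cfg u) r 0 y) (box d (r.+1 * l)))
  (box_edges_uniq N).
have rN' : (r * l <= N)%N by rewrite (leq_trans _ rN)// leq_mul2r leqnSn orbT.
congr (P _); apply/seteqP; split=> w /=.
  move=> [y /open_distS[y1 y2]]; apply/hasP; exists y.
    by have := reach_box y1; rewrite supnorm0.
  by rewrite !reach_trace ?supnorm0// y1.
move=> /hasP[y _]; rewrite !reach_trace ?supnorm0// => /andP[y1 y2].
by exists y; apply/open_distS.
Qed.

Lemma survival : (6 < d)%N -> exists2 c : R, 0 < c & forall r, (1 <= r)%N ->
  ((c / r%:R)%:E <= P [set w | open_sphere R w 0%R r !=set0])%E.
Proof.
move=> d6; have d2 : (2 <= d)%N by exact: leq_trans d6.
have [C C0 hC] := volume_ub d6.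
(* With lam >= C + 1, volume (lam r) >= lam r >= C r + r >= volume r + r: the shell between the two
   radii has mean size at least r. *)
pose lam := (Num.truncn C).+2.
have hlam : C + 1 <= lam%:R.
  by rewrite -natr1 lerD2r ltW// Num.Theory.truncnS_gt.
pose c1 := (C * lam%:R) ^+ 3.
have c10 : 0 < c1 by rewrite exprn_gt0// mulr_gt0// ltr0n.
exists c1^-1; first by rewrite invr_gt0.
move=> -[//|r] _; have r0 : 0 < r.+1%:R :> R by rewrite ltr0n.
pose k := (lam * r.+1)%N; pose N := (k * l)%N; pose D := box d N.
have rk : (r.+1 <= k)%N by rewrite leq_pmull.
have rN : (r.+1 * l <= N)%N by rewrite leq_mul2r rk orbT.
rewrite -/(sphere_event r) (sphere_cyl rN) lee_fin.
set s := box_edges N; set Ev := fun u => has _ _.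
pose f (u : {fset edge E}) : R :=
  \sum_(x <- D) (reach (cfg u) k 0 x && ~~ reach (cfg u) r.+1 0 x)%:R.
have f0 u : 0 <= f u by rewrite sumr_ge0.
have fEv u : f u != 0 -> Ev u.
  move=> fn0; have [x xD] : exists2 x, x \in D & reach (cfg u) k 0 x && ~~ reach (cfg u) r.+1 0 x.
    apply/hasP; apply: contraNT fn0 => /hasPn h; rewrite /f big1_seq// => x /andP[_ xD].
    by rewrite (negbTE (h x xD)).
  move=> /andP[x1 x2]; have [|y /andP[y1 y2]] := reach_sphere (r := r) x1.
    by rewrite reach_sym; apply: contraNN x2; exact: reach_le.
  apply/hasP; exists y; last by rewrite y1 y2.
  by have := reach_box y1; rewrite supnorm0.
have Ef : r.+1%:R <= Ex p s f fset0.
  have -> : Ex p s f fset0 = volume k - volume r.+1.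
    rewrite /f Ex_sum -(sum_preach_eq (D := D) (r := k) (x := 0)); last first.
      by move=> y; rewrite subr0 in_box.
    rewrite -(sum_preach_eq (D := D) (r := r.+1) (x := 0)); last first.
      by move=> y; rewrite subr0 in_box => /leq_trans; apply.
    rewrite -sumrB; apply: eq_bigr => x _.
    rewrite -!(@conn_preach N) ?supnorm0// /conn /Pr -ExB; apply: eq_Ex => u.
    case h : (reach _ r.+1 _ _) => /=; last by rewrite andbT subr0.
    by rewrite (reach_le rk h) subrr.
  rewrite lerBrDr; apply: le_trans (volume_lb k d2); rewrite /k natrM.
  apply: (@le_trans _ _ ((C + 1) * r.+1%:R)); last by rewrite ler_wpM2r.
  by rewrite mulrDl mul1r addrC lerD2r hC.
have Ef2 : Ex p s (fun u => f u ^+ 2) fset0 <= c1 * r.+1%:R ^+ 3.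
  apply: (@le_trans _ _ (volume k ^+ 3)); last first.
    rewrite /c1 -exprMn lerXn2r ?nnegrE ?volume_ge0//.
      by rewrite !mulr_ge0// ltW.
    by rewrite -mulrA -natrM hC// (leq_trans _ rk).
  apply: le_trans (second_moment N k).
  under [leRHS]eq_bigr => x _ do rewrite -Ex_sum.
  rewrite -Ex_sum; apply: Ex_le => // u; rewrite expr2 {1}/f mulr_suml.
  apply: ler_sum => x _; rewrite /f mulr_sumr; apply: ler_sum => y _.
  by rewrite -natrM mulnb ler_nat; do 2 case: (reach _ k _ _); rewrite ?andbF//= leq_b1.
(* With R = r + 1, twice the first moment is at least 2 R, and this [t] brings the second moment
   term down to R; so t times the survival probability is at least R. *)
pose t := c1 * r.+1%:R ^+ 2.
have t0 : 0 < t by rewrite mulr_gt0// exprn_gt0.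
have := Ex_le_AMGM p01 s t0 f0.
have : Pr p s (fun u => f u != 0) <= Pr p s Ev by apply: Pr_le.
set p1 := Pr p s _; set p2 := Pr p s Ev => h1 h2.
have h3 : t^-1 * Ex p s (fun u => f u ^+ 2) fset0 <= r.+1%:R.
  rewrite ler_pdivrMl// /t -mulrA -exprSr; exact: Ef2.
have h4 : r.+1%:R <= t * p2.
  by have h5 := ler_wpM2l (ltW t0) h1; lra.
rewrite -(ler_pM2l t0); apply: le_trans h4.
rewrite le_eqVlt; apply/orP; left; apply/eqP; rewrite /t; field.
by rewrite !gt_eqF.
Qed.

(** The ball is finite and contained in a fixed box, so its cardinality is a finite sum of
    indicators. *)
Lemma integral_ball r :
  (\int[P]_w counting (open_ball R w 0%R r) = (volume r)%:E)%E.
Proof.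
pose D := box d (r * l).
have cE w : counting (open_ball R w 0%R r) =
    (\sum_(y <- D) (\1_[set w' : config E | reach w' r 0 y] w)%:E)%E :> \bar R.
  pose S := [fset y in D | reach w r 0 y]%fset.
  have -> : open_ball R w 0%R r = [set` S].
    apply/seteqP; split=> y /=; rewrite /open_ball /= !inE.
      move=> /open_dist_le h; rewrite h andbT.
      by have := reach_box h; rewrite supnorm0.
    by move=> /andP[_ h]; apply/open_dist_le.
  rewrite /counting asboolT//.
  rewrite set_fsetK sumEFin; congr EFin.
  rewrite (big_fsetID _ (fun y => reach w r 0 y)) /=.
  rewrite [X in _ + X]big1_seq ?addr0; last first.
    by move=> y; rewrite !inE => /andP[_ /andP[_ /negbTE h]]; rewrite indicE memNset//= h.
  transitivity (\sum_(y <- S) (1 : R)); last first.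
    rewrite big_seq [RHS]big_seq; apply: eq_bigr => y; rewrite !inE => /andP[_ h].
    by rewrite indicE mem_set.
  by rewrite big_const_seq count_predT iter_addr_0.
transitivity (\int[P]_w (\sum_(y <- D) (\1_[set w' : config E | reach w' r 0 y] w)%:E))%E.
  by apply: eq_integral => w _.
rewrite ge0_integral_sum//; last first.
  by move=> y; apply/measurable_EFinP; apply: measurable_indic; exact: measurable_reach.
rewrite /volume -sumEFin; apply: eq_bigr => y _.
by rewrite integral_indic ?setIT ?preachE//; exact: measurable_reach.
Qed.

End LatticePercolation.

(** * The critical parameter and the conclusion *)

Lemma critical_probability01 (R : realType) (d : nat) (E : pred {fset 'rV[int]_d})
    (P : R -> probability (config E) R) : 0 <= critical_probability P <= 1.
Proof.
rewrite /critical_probability; set S := [set p | _].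
(* The infimum of the empty set is 0 here, which still lies in [0, 1]. *)
have [->|/set0P[p Sp]] := eqVneq S set0; first by rewrite inf0 lexx ler01.
have S0 : lbound S 0 by move=> q [/andP[]].
apply/andP; split; first by apply: lb_le_inf => //; exists p.
apply: (@le_trans _ _ p); last by case: Sp => /andP[].
by apply: ge_inf => //; exists 0.
Qed.

Theorem theorem1p3 (R : realType) (d : nat) (E : pred {fset 'rV[int]_d})
    (P : R -> probability (config E) R) :
  (6 < d)%N ->
  lattice R E ->
  (forall p, 0 <= p <= 1 -> bernoulli_percolation p (P p)) ->
  two_point_estimate (P (critical_probability P)) ->
  exists2 c : R, 0 < c & forall r : nat, (1 <= r)%N ->
    ((c * r%:R)%:E <=
       \int[P (critical_probability P)]_w counting (open_ball R w 0%R r))%E /\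
    ((c / r%:R)%:E <=
       P (critical_probability P) [set w | open_sphere R w 0%R r !=set0])%E.
Proof.
move=> d6 hE hP [a [A [a0 aA two_point]]].
have d2 : (2 <= d)%N by exact: leq_trans d6.
have p01 := critical_probability01 P.
have hPc := hP _ p01.
have [l hl] := edge_range hE.
have [c c0 hc] := survival hE hl p01 hPc a0 aA two_point d6.
(* The volume bound holds with constant 1, survival with [c]. *)
exists (Num.min 1 c); first by rewrite lt_min ltr01 c0.
move=> r r1; split.
  rewrite (integral_ball hl hPc) lee_fin.
  apply: (le_trans _ (volume_lb hE hl p01 hPc a0 aA two_point r d2)).
  by rewrite ler_piMl// ge_min lexx.
apply: le_trans (hc r r1); rewrite lee_fin ler_wpM2r ?invr_ge0//.
by rewrite ge_min lexx orbT.
Qed.
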